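(* Let $r\ge 0$ be an integer and let $f,\varphi\in L^2(\mu)$ be two probability densities with respect to the standard normal distribution $\mu$ whose moments match the moments of $\mu$ up to order $r$. Assume moreover that $\varphi$ is polynomial; in particular $\varphi=1+\sum_{k=r+1}^N\varphi_k\bar H_k$ (the case $\varphi=1$ being treated by the convention in the context). Set $$a_\varphi:=\left(1+\frac{N}{r+1}\right)^{-1/4}\in(0,1],$$ and for all $a\in(0,1)$, $$d_\varphi(a):=\sum_{k=r+1}^N\frac{|\varphi_k|}{\sqrt{k!}}\left(-2(r+1+N)\left(1+\frac{N}{r+1}\right)\log a\right)^{k/2}.$$ If $\varphi$ satisfies Hypothesis (H) of the context (with $K=r+1$), then for all $a\in(a_\varphi,1)$, $$\chi_2\left(af*\sqrt{1-a^2}\,\varphi\right)\le a^{r+1}\left(1+d_\varphi(a)\right)\chi_2(f)+(1-a^2)^{\frac{r+1}{2}}\chi_2(\varphi).$$ Moreover, $\lim_{a\to1}|\log a|^{-\frac{r+1}{2}}d_\varphi(a)<+\infty$.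
   Context: $\mu$ is the standard normal distribution on $\mathbb{R}$. For a probability density $f\in L^2(\mu)$ with respect to $\mu$ (i.e. $f\ge 0$, $\int f\,d\mu=1$), $\chi_2(f):=\left(\int (f-1)^2\,d\mu\right)^{1/2}$. For two such densities $f,\varphi$ and $a,b\in\mathbb{R}$ with $a^2+b^2=1$, $af*b\varphi$ denotes the density with respect to $\mu$ of $aU+bV$, where $U,V$ are independent with densities $f$ and $\varphi$ with respect to $\mu$. Moments matching up to order $r$ means $\int x^k f\,d\mu=\int x^k\,d\mu$ for $k=1,\dots,r$ (no condition if $r=0$). Normalized Hermite polynomials: $\bar H_n(x)=\frac{(-1)^n}{\sqrt{n!}}e^{x^2/2}D^n(e^{-x^2/2})$ for $n\ge 0$ (with $D=d/dx$); they form an orthonormal basis of $L^2(\mu)$, and $g_k:=\int g\bar H_k\,d\mu$ denotes the $k$-th coefficient of $g\in L^2(\mu)$. Hypothesis (H). Let $K:=r+1$ and let $\varphi$ be a polynomial probability density with respect to $\mu$ whose moments match those of $\mu$ up to order $r$. Then either $\varphi=1$, or $\varphi=1+\sum_{k=K}^N\varphi_k\bar H_k$ with $N=\deg\varphi\ge K$. If $\varphi=1$, one sets by convention $K=+\infty$ and $N=0$ (so that the conditions below are void), $a_\varphi=0$ and $d_\varphi(a)=0$ for all $a$. Otherwise put $$C_k:=\left(1+\frac NK\right)^{k/2},\qquad \gamma_k:=\frac{1}{\sqrt{k!}}\,C_k|\varphi_k| ,$$ and (H) means that all of the following hold (with $0^0=1$): (H1) if $K\le N-2$, then $(k+2)\gamma_{k+2}\le\gamma_k$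 for all $K\le k\le N-2$; (H2a) if $K\le N-1$, then $$\max\left\{\left(\frac{2(K+1)\gamma_{K+1}}{N}\right)^N\left(\frac{K-1}{2\gamma_N}\right)^{K-1},\ \left(\frac{2K\gamma_K}{N-1}\right)^{N-1}\left(\frac{K-2}{2\gamma_{N-1}}\right)^{K-2}\right\}\le\frac{1}{(N-K+1)^{N-K+1}};$$ (H2b) if $K=N$, then $\gamma_N\le\frac{1}{2(N-2)^{(N-2)/2}}$.
   Formalization: For r=0 (K=1) and N≥2, the second term of (H2a), with its negative base and exponent −1, is read as +∞ unless γ_1=0, so (H) then requires φ_1=0; read literally it is void and the inequality fails for every φ with φ_1≠0. Where γ_{N−1}=0, p/0=+∞ and 0·∞=0. *)

(* Defs.v *)
From HB Require Import structures.
From mathcomp Require Import all_boot all_order all_algebra.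
From mathcomp Require Import all_classical all_reals all_analysis.

Set Implicit Arguments.
Unset Strict Implicit.
Unset Printing Implicit Defensive.

Import Order.TTheory GRing.Theory Num.Theory.
Import numFieldNormedType.Exports.

Local Open Scope classical_set_scope.
Local Open Scope ring_scope.

Definition gauss {R : realType} : probability (measurableTypeR R) R :=
  normal_prob 0 1.

Section densities.
Context {R : realType}.
Implicit Types f : R -> R.

Definition is_density f : Prop :=
  [/\ measurable_fun [set: R] f, forall x, 0 <= f x
    & (\int[gauss]_x (f x)%:E = 1)%E].

Definition moments_match (r : nat) f : Prop :=
  forall k : nat, (1 <= k <= r)%N ->
    (\int[gauss]_x (x ^+ k * f x)%:E = \int[gauss]_x (x ^+ k)%:E)%E.

(* Extended-real valued on extended-real functions, so that it applies to
   Radon-Nikodym derivatives and that an upper bound on it includes its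
   finiteness. *)
Definition chi2 (g : R -> \bar R) : \bar R :=
  Lnorm gauss 2%:E (fun x => (g x - 1)%E).

End densities.

Section random_variables.
Context d (T : measurableType d) (R : realType) (P : probability T R).
Implicit Types X U V : {RV P >-> R}.

(* The law of X, on the copy of R that carries normal_prob. *)
Definition law X : set (measurableTypeR R) -> \bar R := distribution P X.

Section law_probability.
Variable X : {RV P >-> R}.

Let law0 : law X set0 = 0%E. Proof. exact: measure0. Qed.

Let law_ge0 A : (0 <= law X A)%E.
Proof. exact: (@measure_ge0 _ R R (distribution P X)). Qed.

Let law_sigma_additive : semi_sigma_additive (law X).
Proof. exact: (@measure_semi_sigma_additive _ R R (distribution P X)). Qed.

HB.instance Definition _ := isMeasure.Build _ _ _ (law X)
  law0 law_ge0 law_sigma_additive.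

Let law_setT : law X [set: _] = 1%E.
Proof. exact: (@probability_setT _ R R (distribution P X)). Qed.

HB.instance Definition _ := Measure_isProbability.Build _ _ _
  (law X) law_setT.

End law_probability.

Definition has_density X (f : R -> R) : Prop :=
  forall A, measurable A -> law X A = (\int[gauss]_(x in A) (f x)%:E)%E.

Definition independent U V : Prop :=
  forall A B : set R, measurable A -> measurable B ->
    P (U @^-1` A `&` V @^-1` B) = (P (U @^-1` A) * P (V @^-1` B))%E.

(* The density of X with respect to gauss. The library's Radon-Nikodym
   derivative is constantly -oo when the law of X is not absolutely continuous,
   and chi2 is then +oo. *)
Definition density_of X : R -> \bar R :=
  Radon_Nikodym (charge_of_finite_measure (law X)) gauss.

End random_variables.

Section hermite.
Context {R : realType}.

Definition hermite (n : nat) (x : R) : R :=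
  (-1) ^+ n / Num.sqrt (n`!)%:R * expR (x ^+ 2 / 2)
  * derive1n n (fun y : R => expR (- (y ^+ 2 / 2))) x.

Definition hcoef (g : R -> R) (k : nat) : R :=
  \int[gauss]_x (g x * hermite k x).

End hermite.

Section hypothesis_H.
Context {R : realType}.
Implicit Types (K N : nat) (phi : {poly R}).

Definition deg phi : nat := (size phi).-1.

Definition Cst K N (k : nat) : R := (1 + N%:R / K%:R) `^ (k%:R / 2).

Definition gam K phi (k : nat) : R :=
  (Num.sqrt (k`!)%:R)^-1 * Cst K (deg phi) k * `|hcoef (horner phi) k|.

Definition H1 K phi : Prop :=
  forall k : nat, (K <= k)%N -> (k + 2 <= deg phi)%N ->
    (k + 2)%:R * gam K phi (k + 2) <= gam K phi k.

(* (p / b) ^ p for p : int and b >= 0, with value in [0, +oo] and 0 ^ 0 = 1.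
   It occurs only as the second factor of
     (c / q) ^ q * (p / b) ^ p <= (q - p) ^ - (q - p),
   which, for c >= 0 and 0 <= p < q, says that c * t ^ p <= 1 + b * t ^ q for
   all t > 0. When b = 0 < p that requires c = 0: this is rendered by
   p / 0 = +oo and 0 * +oo = 0. When p = -1, which happens only for K = 1, the
   base is not nonnegative and the power is no longer meaningful; the
   inequality in t again forces c = 0, whence the value +oo. *)
Definition ratio_pow (p : int) (b : R) : \bar R :=
  match p with
  | Posz n => ((n%:R%:E / b%:E) ^+ n)%E
  | Negz _ => +oo%E
  end.

Definition H2a K phi : Prop :=
  let N := deg phi in let g := gam K phi in
  (K < N)%N ->
  (maxe
     (((2 * (K + 1)%:R * g (K + 1)%N / N%:R) ^+ N)%:E
        * ratio_pow (K%:Z - 1) (2 * g N))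
     (((2 * K%:R * g K / (N - 1)%:R) ^+ (N - 1))%:E
        * ratio_pow (K%:Z - 2) (2 * g (N - 1)%N))
   <= (1 / (N - K + 1)%:R ^+ (N - K + 1))%:E)%E.

(* For N = 1 the power has a negative base and is not meaningful, but no
   polynomial of degree 1 is nonnegative. *)
Definition H2b K phi : Prop :=
  let N := deg phi in
  K = N ->
  gam K phi N <= 1 / (2 * (N%:R - 2) `^ ((N%:R - 2) / 2)).

Definition hypH (r : nat) phi : Prop :=
  phi <> 1 -> [/\ H1 r.+1 phi, H2a r.+1 phi & H2b r.+1 phi].

Definition a_phi (r : nat) phi : R :=
  if phi == 1 then 0 else (1 + (deg phi)%:R / r.+1%:R) `^ (- (1 / 4)).

(* The sum is empty when phi = 1, since then deg phi = 0. *)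
Definition d_phi (r : nat) phi (a : R) : R :=
  \sum_(r.+1 <= k < (deg phi).+1)
    `|hcoef (horner phi) k| / Num.sqrt (k`!)%:R
    * (- 2 * (r.+1 + deg phi)%:R * (1 + (deg phi)%:R / r.+1%:R) * ln a)
      `^ (k%:R / 2).

End hypothesis_H.

(* Main.v *)
Require Import Defs.
From HB Require Import structures.
From mathcomp Require Import all_boot all_order all_algebra.
From mathcomp Require Import all_classical all_reals all_analysis.
From mathcomp Require Import measurable_realfun ring lra.

Import Order.TTheory GRing.Theory Num.Theory.
Import numFieldNormedType.Exports.

(** For a polynomial [p] with Hermite coefficients [q_n], the integral of [p]
    under the law of [aU + bV] is bilinear in the coefficients of [f] and [phi],
    because He_n(ax+by) = sum_j C(n,j) a^j b^(n-j) He_j(x) He_(n-j)(y) when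
    a^2 + b^2 = 1.  The terms with [j = 0] contribute at most [b^(r+1)] times
    the distance of [phi] to 1, and the others are controlled by a Schur test
    for the matrix sqrt(C(n,j)) a^j b^(n-j) |phi_(n-j)|.  Since
    C(n,k) k! <= n^k, 1 - a^2 <= 2 |log a| and a^(-2) <= 1 + N/(r+1), its row
    and column sums of index n >= r+1+N are at most a^n P(u), where
    P(u) = 1 + sum_k gamma_k u^k and u = sqrt(2 n |log a|).  As
    a^n = exp(-u^2/2) and hypothesis (H) says that P'(u) <= u P(u), this
    decreases with n; its value at n = r+1+N is at most
    a^(r+1) (1 + d_phi(a)), which also bounds the sums of smaller index.

    The resulting inequality between [p] and the law extends from polynomials to
    bounded measurable functions by density in L^2 of the Gaussian measure;
    truncations of the Radon-Nikodym derivative are then admissible test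
    functions, and monotone convergence gives the bound on chi2. *)

Set Implicit Arguments.
Unset Strict Implicit.
Unset Printing Implicit Defensive.

Local Open Scope classical_set_scope.
Local Open Scope ring_scope.

(** * Hermite polynomials *)

Section hermite_polynomials.
Context {R : realType}.
Implicit Types (x y a b : R) (n k : nat).

(** Two obstacles shape the argument. The density of [aU + bV] is only given as a Radon-Nikodym
    derivative, and its square integrability is part of the claim. Its norm is therefore reached by
    duality, in the form [2 (nu(q) - gamma(q)) <= gamma(q^2) + M^2], where [nu] is the law and
    [gamma] the Gaussian measure. This form contains no square root and tolerates small errors; when
    [q] is a truncation of the density minus 1, its left side is [2 gamma(q^2)], whence
    [gamma(q^2) <= M^2]. The other obstacle is that the mixing matrix is not symmetric. Row [n]
    carries [a^(n-k)] instead of [a^n], and column [j] carries binomials of rows up to [j + N]. With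
    [rho = 1 + N/K], either defect costs a factor [sqrt(rho)^k]: in rows because
    [a^(-k) <= sqrt(rho)^k], in columns because [j + N <= rho j] for [j >= K]. This is the origin of
    the constants [C_k] in [gamma_k]. Only entries with [j >= K] enter the test, since the
    coefficients of [f] of index strictly between 0 and [K] vanish. *)

Fixpoint He n : {poly R} :=
  if n is m.+1 then 'X * He m - (He m)^`() else 1.

Lemma HeS n : He n.+1 = 'X * He n - (He n)^`().
Proof. by []. Qed.

Lemma deriv_He n : (He n.+1)^`() = n.+1%:R *: He n.
Proof.
elim: n => [|n IH].
  by rewrite HeS derivB derivM derivX /= derivC deriv0 mulr0 mul1r addr0 subr0 scale1r.
rewrite HeS derivB derivM derivX {2}IH IH derivZ mul1r -scalerAr.
rewrite -addrA -scalerBr -HeS.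
by rewrite -[X in X + _]scale1r -scalerDl nat1r.
Qed.

Lemma horner_HeS n x :
  (He n.+1).[x] = x * (He n).[x] - n%:R * (He n.-1).[x].
Proof.
rewrite HeS !hornerE; congr (_ - _).
case: n => [|n]; first by rewrite /= derivC horner0 mul0r.
by rewrite deriv_He hornerZ.
Qed.

Lemma size_He n : size (He n) = n.+1 /\ He n \is monic.
Proof.
elim: n => [|n [sn mn]]; first by rewrite size_poly1 monic1.
have s1 : size ('X * He n) = n.+2.
  by rewrite -commr_polyX size_mulX ?sn// -size_poly_eq0 sn.
have s2 : (size (- (He n)^`())%R < size ('X * He n)%R)%N.
  by rewrite size_polyN s1 -sn ltnS ltnW// lt_size_deriv// monic_neq0.
split; first by rewrite HeS size_polyDl.
rewrite HeS; apply/monicP; rewrite lead_coefDl//.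
by rewrite lead_coefM lead_coefX (monicP mn) mulr1.
Qed.

Lemma He_span n (p : {poly R}) : (size p <= n)%N ->
  exists c : nat -> R, p = \sum_(i < n) c i *: He i.
Proof.
elim: n p => [|n IH] p sp.
  exists (fun=> 0); rewrite big_ord0; apply/eqP.
  by rewrite -size_poly_leq0.
have [sn mn] := size_He n.
have : (size (p - p`_n *: He n)%R <= n)%N.
  apply/leq_sizeP => j; rewrite leq_eqVlt => /predU1P[<-|nj].
    rewrite coefB coefZ; have := monicP mn.
    by rewrite lead_coefE sn /= => ->; rewrite mulr1 subrr.
  rewrite coefB coefZ [p`_j]nth_default ?(leq_trans sp)//.
  by rewrite [(He n)`_j]nth_default ?sn// mulr0 subr0.
move=> /IH[c pc]; exists (fun i => if i == n then p`_n else c i).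
rewrite big_ord_recr/= eqxx -[LHS](subrK (p`_n *: He n)) pc; congr (_ + _).
by apply: eq_bigr => i _; rewrite ltn_eqF.
Qed.

(** Pascal's rule, in the shape used by the induction for the addition formula. *)
Lemma binomial_sumS (A B : nat -> R) n :
  \sum_(k < n.+2) 'C(n.+1, k)%:R * A k * B (n.+1 - k)%N =
  \sum_(k < n.+1) 'C(n, k)%:R * (A k.+1 * B (n - k)%N + A k * B (n.+1 - k)%N).
Proof.
rewrite big_ord_recl bin0 subn0 mul1r.
under eq_bigr do rewrite lift0 binS natrD -mulrA mulrDl subSS.
rewrite big_split/= addrA addrC.
under [RHS]eq_bigr do rewrite mulrDr.
rewrite big_split/=; congr (_ + _).
rewrite [RHS]big_ord_recl bin0 mul1r subn0 big_ord_recr /= bin_small//.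
by rewrite mul0r addr0.
Qed.

(** Absorption [k C(n+1,k) = (n+1) C(n,k-1)]. This identity and its mirror image reduce the
    lower-order terms of the recurrences in [x] and in [y] to one and the same sum of rank [n]. *)
Lemma binomial_sum_diffl (A B : nat -> R) n :
  \sum_(k < n.+2) 'C(n.+1, k)%:R * (k%:R * A k.-1 * B (n.+1 - k)%N) =
  n.+1%:R * \sum_(k < n.+1) 'C(n, k)%:R * A k * B (n - k)%N.
Proof.
rewrite big_ord_recl !mul0r mulr0 add0r mulr_sumr; apply: eq_bigr => k _.
rewrite lift0 subSS /=.
have := mul_bin_diag n.+1 k => /(congr1 (fun m => m%:R : R)); rewrite !natrM => E.
by rewrite mulrA (mulrA n.+1%:R) (mulrA n.+1%:R) E; ring.
Qed.

Lemma binomial_sum_diffr (A B : nat -> R) n :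
  \sum_(k < n.+2) 'C(n.+1, k)%:R * ((n.+1 - k)%:R * A k * B (n.+1 - k).-1%N) =
  n.+1%:R * \sum_(k < n.+1) 'C(n, k)%:R * A k * B (n - k)%N.
Proof.
rewrite big_ord_recr/= subnn !mul0r mulr0 addr0 mulr_sumr; apply: eq_bigr => k _.
have kn : (k <= n)%N by rewrite -ltnS.
have := mul_bin_down n.+1 k => /(congr1 (fun m => m%:R : R)); rewrite !natrM => E.
rewrite /= subSn//= in E *; rewrite mulrA (mulrA n.+1%:R) (mulrA n.+1%:R) E; ring.
Qed.

(** The generating function [exp(t z - t^2/2)] factors at [z = a x + b y] because
    [t^2 = (a t)^2 + (b t)^2]. The proof is the corresponding induction on the three-term
    recurrence, hence over two consecutive ranks. *)
Lemma He_add a b x y n : a ^+ 2 + b ^+ 2 = 1 ->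
  (He n).[a * x + b * y] =
  \sum_(k < n.+1) 'C(n, k)%:R * (a ^+ k * (He k).[x])
     * (b ^+ (n - k) * (He (n - k)).[y]).
Proof.
move=> ab1; pose A k := a ^+ k * (He k).[x]; pose B k := b ^+ k * (He k).[y].
suff [] : (He n).[a * x + b * y] = \sum_(k < n.+1) 'C(n, k)%:R * A k * B (n - k)%N
  /\ (He n.+1).[a * x + b * y] =
     \sum_(k < n.+2) 'C(n.+1, k)%:R * A k * B (n.+1 - k)%N by [].
have AS k : A k.+1 = a * x * A k - a ^+ 2 * (k%:R * A k.-1).
  rewrite /A horner_HeS; case: k => [|k]/=; rewrite ?exprS; ring.
have BS k : B k.+1 = b * y * B k - b ^+ 2 * (k%:R * B k.-1).
  rewrite /B horner_HeS; case: k => [|k]/=; rewrite ?exprS; ring.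
elim: n => [|n [IH1 IH2]].
  split; first by rewrite big_ord1 bin0 /A /B /= !expr0 !hornerC !mulr1.
  rewrite !big_ord_recr big_ord0 /= /A /B /= derivC !hornerE /=.
  by rewrite !expr0 !expr1 !(mulr1, mul1r, subr0, add0r) addrC.
split => //; rewrite horner_HeS IH2 /= IH1.
(* The lower-order term is multiplied by [1 = a^2 + b^2] and split: the [a^2] part completes the
   recurrence of [A], the [b^2] part that of [B]. *)
transitivity ((a * x + b * y) * (\sum_(k < n.+2) 'C(n.+1, k)%:R * A k * B (n.+1 - k)%N)
  - a ^+ 2 * (\sum_(k < n.+2) 'C(n.+1, k)%:R * (k%:R * A k.-1 * B (n.+1 - k)%N))
  - b ^+ 2 * (\sum_(k < n.+2) 'C(n.+1, k)%:R * ((n.+1 - k)%:R * A k * B (n.+1 - k).-1%N))).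
  rewrite binomial_sum_diffl binomial_sum_diffr -addrA -opprD -mulrDl ab1.
  by rewrite mul1r.
rewrite [RHS]binomial_sumS !mulr_sumr -!sumrB; apply: eq_bigr => k _.
rewrite AS [(n.+2 - k)%N]subSn ?BS; last by rewrite -ltnS.
ring.
Qed.

Lemma is_derive_gaussian x :
  is_derive x (1:R) (fun y : R => expR (- (y ^+ 2 / 2)))
    (- x * expR (- (x ^+ 2 / 2))).
Proof.
have e1 : is_derive x (1:R) (fun y : R => - (y ^+ 2 / 2)) (- x).
  apply: is_derive_eq.
  by rewrite /= /GRing.scale /=; field.
have := @is_derive1_comp R expR _ x _ _ (is_derive_expR (- (x ^+ 2 / 2))) e1.
by rewrite mulrC.
Qed.

Lemma derive1n_gauss n :
  derive1n n (fun y : R => expR (- (y ^+ 2 / 2))) =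
  (fun x => (-1) ^+ n * (He n).[x] * expR (- (x ^+ 2 / 2))).
Proof.
elim: n => [|n IH].
  by apply/funext => x; rewrite /= hornerC expr0 !mul1r.
rewrite derive1nS IH; apply/funext => x; rewrite derive1E.
have e2 := is_derive_gaussian x.
have e3 := is_derive_poly (He n) x.
rewrite (_ : (fun y => _) = (fun y => (-1) ^+ n *: (horner (He n) y * expR (- (y ^+ 2 / 2))))); last first.
  by apply/funext => y; rewrite -mulrA.
rewrite derive_val.
rewrite HeS hornerD hornerN hornerM hornerX (exprS (-1)).
have sE (u v : R) : u *: (v : R^o) = u * v by [].
rewrite !sE.
ring.
Qed.

Lemma hermiteE n x : hermite n x = (He n).[x] / Num.sqrt (n`!)%:R.
Proof.
rewrite /hermite derive1n_gauss.
have -> : (-1) ^+ n / Num.sqrt (n`!)%:R * expR (x ^+ 2 / 2) *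
  ((-1) ^+ n * (He n).[x] * expR (- (x ^+ 2 / 2))) =
  ((-1) ^+ n * (-1) ^+ n) * (expR (x ^+ 2 / 2) * expR (- (x ^+ 2 / 2))) *
  ((He n).[x] / Num.sqrt (n`!)%:R) :> R by ring.
by rewrite -exprMn mulrNN mulr1 expr1n mul1r -expRD subrr expR0 mul1r.
Qed.

End hermite_polynomials.

(** * Gaussian integrals *)

Section density_integral.
Local Open Scope ereal_scope.
Context d (T : measurableType d) (R : realType).
Variables (mu : {sigma_finite_measure set T -> \bar R})
  (m : {finite_measure set T -> \bar R}) (f : T -> R).
Hypothesis mf : measurable_fun [set: T] f.
Hypothesis f0 : forall x, (0 <= f x)%R.
Hypothesis mE : forall A, measurable A -> m A = \int[mu]_(x in A) (f x)%:E.

(** [f] and the Radon-Nikodym derivative of [m] have the same integrals over measurable sets, so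
    they agree almost everywhere and the change of variables for the latter applies to [f]. *)
Lemma ge0_integral_density (g : T -> \bar R) : measurable_fun [set: T] g ->
  (forall x, 0 <= g x) -> \int[m]_x g x = \int[mu]_x (g x * (f x)%:E).
Proof.
move=> mg g0.
have mEf : measurable_fun [set: T] (EFin \o f) by exact/measurable_EFinP.
have mmu : m `<< mu.
  apply/null_content_dominatesP => A mA muA; rewrite mE//.
  by apply: null_set_integral => //; exact: measurable_funTS.
rewrite -(Radon_Nikodym_SigmaFinite.change_of_variables mmu)//.
apply: ae_eq_integral => //.
- apply: emeasurable_funM => //.
  exact: measurable_int (Radon_Nikodym_SigmaFinite.f_integrable mmu).
- exact: emeasurable_funM.
- have : ae_eq mu [set: T] (Radon_Nikodym_SigmaFinite.f m mu) (EFin \o f).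
    apply: integral_ae_eq => //.
      exact: Radon_Nikodym_SigmaFinite.f_integrable.
    move=> E _ E_m; rewrite -(Radon_Nikodym_SigmaFinite.f_integral mmu)// mE//.
  by apply: filterS => x /= /(_ I) ->.
Qed.

Lemma integral_density (g : T -> R) : measurable_fun [set: T] g ->
  \int[m]_x (g x)%:E = \int[mu]_x (g x * f x)%:E.
Proof.
move=> mg; rewrite [LHS]integralE [RHS]integralE.
have mEg : measurable_fun [set: T] (EFin \o g) by exact/measurable_EFinP.
rewrite !ge0_integral_density//; [|exact: measurable_funeneg|exact: measurable_funepos].
congr (_ - _); apply: eq_integral => x _.
  rewrite !funeposE EFinM.
  by rewrite maxe_pMl ?lee_fin// mul0e.
rewrite !funenegE EFinM.
by rewrite -mulNe maxe_pMl ?lee_fin// mul0e.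
Qed.

Lemma integrable_density (g : T -> R) : measurable_fun [set: T] g ->
  mu.-integrable [set: T] (fun x => (g x * f x)%:E) ->
  m.-integrable [set: T] (fun x => (g x)%:E).
Proof.
move=> mg /integrableP[_ gf]; apply/integrableP; split.
  exact/measurable_EFinP.
rewrite ge0_integral_density//; last first.
  by apply: measurableT_comp => //; exact/measurable_EFinP.
under eq_integral do rewrite -[(f _)%:E]gee0_abs ?lee_fin// -abseM.
exact: gf.
Qed.

End density_integral.

(** The image of Lebesgue measure under [x -> c + b x], scaled by [b], gives every interval its
    length, so it is Lebesgue measure. *)
Lemma ge0_integral_affine {R : realType} (c b : R) (g : R -> \bar R) : 0 < b ->
  measurable_fun [set: R] g -> (forall x, 0 <= g x)%E ->
  (\int[lebesgue_measure]_x g x = b%:E * \int[lebesgue_measure]_x g (c + b * x)%R)%E.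
Proof.
move=> b0 mg g0.
pose F : measurableTypeR R -> measurableTypeR R := fun x => c + b * x.
have mF : measurable_fun [set: measurableTypeR R] F.
  by apply: measurable_funD => //; exact: measurable_funM.
pose F_mixin := isMeasurableFun.Build _ _ _ _ F mF.
pose F_pack : {mfun measurableTypeR R >-> measurableTypeR R} := HB.pack F F_mixin.
have b_ge0 := ltW b0.
have [nu nuE] : exists nu : {measure set (measurableTypeR R) -> \bar R},
    (forall A, nu A = b%:E * lebesgue_measure (F @^-1` A))%E /\
    (\int[nu]_x g x = b%:E * \int[lebesgue_measure]_x g (F x))%E.
  unshelve eexists; first unshelve refine (mscale (NngNum b_ge0) (pushforward lebesgue_measure F_pack)).
    exact: mF.
  split => //.
  rewrite ge0_integral_mscale//=; congr (_ * _)%E.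
  by rewrite ge0_integral_pushforward.
rewrite -nuE.2; apply: eq_measure_integral => A mA _.
apply: lebesgue_measure_unique mA => _ [[u v]] _ <-.
rewrite nuE.1.
have -> : F @^-1` `]u, v] = `](u - c) / b, (v - c) / b]%classic.
  apply/seteqP; split => x /=; rewrite !in_itv/= /F.
    by rewrite ltr_pdivrMr// ler_pdivlMr// ltrBlDl lerBrDl mulrC.
  by rewrite ltr_pdivrMr// ler_pdivlMr// ltrBlDl lerBrDl mulrC.
rewrite !lebesgue_measure_itv /= !lte_fin ltr_pM2r ?invr_gt0// ltrD2r.
case: ifPn => _; last by rewrite mule0.
by rewrite -!EFinD -EFinM; congr EFin; field; rewrite gt_eqF.
Qed.

Section gaussian.
Context {R : realType}.
Implicit Types (a b x y z : R) (p q : {poly R}).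
Local Notation mu := (@lebesgue_measure R).
Local Notation gaussR := (@gauss R).

Lemma normal_pdf01E x : normal_pdf 0 1 x = normal_peak 1 * expR (- (x ^+ 2 / 2)).
Proof.
rewrite normal_pdfE ?oner_neq0// /normal_fun subr0 expr1n.
by congr (_ * expR _); field.
Qed.

Lemma ge0_integral_gauss (g : R -> \bar R) : measurable_fun [set: R] g ->
  (forall x, 0 <= g x)%E ->
  (\int[gauss]_x g x = \int[mu]_x (g x * (normal_pdf 0 1 x)%:E))%E.
Proof.
move=> mg g0; apply: (@ge0_integral_density _ _ _ mu gaussR) => //.
  exact: measurable_normal_pdf.
Qed.

Lemma integral_gauss (g : R -> R) : measurable_fun [set: R] g ->
  (\int[gauss]_x (g x)%:E = \int[mu]_x (g x * normal_pdf 0 1 x)%:E)%E.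
Proof.
move=> mg; apply: (@integral_density _ _ _ mu gaussR) => //.
  exact: measurable_normal_pdf.
by move=> x; rewrite normal_pdf_ge0.
Qed.

(** Completing the square turns the integrand into [exp(c^2/2)] times the normal density of mean
    [c]. *)
Lemma integral_gauss_expR (c : R) :
  (\int[gauss]_x (expR (c * x))%:E = (expR (c ^+ 2 / 2))%:E)%E.
Proof.
rewrite integral_gauss; last by apply: measurableT_comp => //; exact: measurable_funM.
have E x : expR (c * x) * normal_pdf 0 1 x = expR (c ^+ 2 / 2) * normal_pdf c 1 x.
  rewrite normal_pdf01E normal_pdfE ?oner_neq0// /normal_fun.
  rewrite mulrCA [RHS]mulrCA -!expRD; congr (_ * expR _).
  by rewrite expr1n; field.
under eq_integral do rewrite E EFinM.
rewrite ge0_integralZl ?lee_fin ?expR_ge0//.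
- by rewrite integral_normal_pdf mule1.
- by apply/measurable_EFinP; exact: measurable_normal_pdf.
- by move=> x _; rewrite lee_fin normal_pdf_ge0.
Qed.

(** [exp(c |x|)] is at most [exp(c x) + exp(- c x)]. These functions dominate all polynomials, and
    later all Taylor polynomials of a sine at once. *)
Lemma integrable_expR_norm (c : R) :
  gaussR.-integrable [set: R] (fun x => (expR (c * `|x|))%:E).
Proof.
have i1 (e : R) : gaussR.-integrable [set: R] (fun x => (expR (e * x))%:E).
  apply/integrableP; split.
    by apply/measurable_EFinP; apply: measurableT_comp => //; exact: measurable_funM.
  under eq_integral do rewrite gee0_abs ?lee_fin ?expR_ge0//.
  by rewrite integral_gauss_expR ltry.
have := integrableD measurableT (i1 c) (i1 (- c)).
apply: le_integrable => //.
  by apply/measurable_EFinP; apply: measurableT_comp => //; apply: measurable_funM.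
move=> x _; rewrite -EFinD !abse_EFin lee_fin (ger0_norm (expR_ge0 _)) ger0_norm ?addr_ge0 ?expR_ge0//.
have [x0|x0] := ger0P x.
  by rewrite lerDl expR_ge0.
by rewrite mulrN mulNr lerDr expR_ge0.
Qed.

Lemma horner_bound p : exists2 C : R, 0 <= C & forall x, `|p.[x]| <= C * expR `|x|.
Proof.
exists (\sum_(i < size p) `|p`_i| * i`!%:R).
  by apply: sumr_ge0 => i _; rewrite mulr_ge0.
move=> x; rewrite horner_coef mulr_suml.
apply: le_trans (ler_norm_sum _ _ _) _; apply: ler_sum => i _.
rewrite normrM -mulrA ler_wpM2l// normrX mulrC -ler_pdivrMr ?ltr0n ?fact_gt0//.
case: (i : nat) => [|n].
  by rewrite expr0 fact0 divr1 -expR0 ler_expR.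
by apply: le_trans (expR_ge1Dxn n (normr_ge0 x)); rewrite lerDr.
Qed.

Lemma measurable_horner p : measurable_fun [set: R] (horner p).
Proof. by apply: continuous_measurable_fun; exact: continuous_horner. Qed.

Lemma integrable_horner p : gaussR.-integrable [set: R] (fun x => (p.[x])%:E).
Proof.
have [C C0 Cp] := horner_bound p.
have := integrableZl measurableT C (integrable_expR_norm 1).
apply: le_integrable => //.
  by apply/measurable_EFinP; exact: measurable_horner.
by move=> x _; rewrite /= lee_fin mul1r (le_trans (Cp x))// ler_norm.
Qed.

Lemma Lfun2P (g : R -> R) : measurable_fun [set: R] g ->
  (\int[gauss]_x (g x ^+ 2)%:E < +oo)%E -> g \in Lfun gaussR 2%:E.
Proof.
move=> mg g2; rewrite inE; apply/andP; split; rewrite inE//=.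
rewrite /finite_norm unlock /Lnorm /= poweR_lty//.
under eq_integral => x _ do rewrite powR_mulrn// real_normK ?num_real//.
exact: g2.
Qed.

Lemma horner_Lfun2 p : horner p \in Lfun gaussR 2%:E.
Proof.
apply: Lfun2P; first exact: measurable_horner.
have /integrableP[_] := integrable_horner (p ^+ 2).
under eq_integral do rewrite horner_exp gee0_abs ?lee_fin ?sqr_ge0//.
by [].
Qed.

(** Boundary terms of the integration by parts. From [|x p(x)| <= C exp |x|] and
    [|x| - x^2/2 <= 1/2], they are [O(1/|x|)]. *)
Lemma poly_gaussian_cvg0 p :
  (p.[n%:R] * normal_pdf 0 1 n%:R) @[n --> \oo] --> (0 : R) /\
  (p.[- n%:R] * normal_pdf 0 1 (- n%:R)) @[n --> \oo] --> (0 : R).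
Proof.
have [C C0 Cp] := horner_bound ('X * p).
have H x : 0 < `|x| -> `|p.[x] * normal_pdf 0 1 x| <= normal_peak 1 * C * expR 2^-1 * `|x|^-1.
  move=> x0; rewrite ler_pdivlMr// normal_pdf01E normrM.
  rewrite [X in `|_| * X]ger0_norm; last first.
    by rewrite mulr_ge0 ?expR_ge0// normal_peak_ge0.
  have := Cp x; rewrite hornerM hornerX normrM => Cx.
  rewrite (_ : _ * `|x| = normal_peak 1 * ((`|x| * `|p.[x]|) * expR (- (x ^+ 2 / 2)))); last by ring.
  rewrite -!mulrA ler_wpM2l ?normal_peak_ge0// mulrA.
  apply: le_trans (ler_wpM2r (expR_ge0 _) Cx) _.
  rewrite -mulrA ler_wpM2l// -expRD ler_expR.
  have := sqr_ge0 (`|x| - 1); have : `|x| ^+ 2 = x ^+ 2 by rewrite real_normK ?num_real.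
  nra.
have cv : normal_peak 1 * C * expR 2^-1 * n.+1%:R^-1 @[n --> \oo] --> (0 : R).
  rewrite -[X in _ --> X](mulr0 (normal_peak 1 * C * expR 2^-1)).
  by apply: cvgM; [exact: cvg_cst|exact: cvg_harmonic].
split; rewrite -(@cvg_shiftS _ _ _).
  apply/norm_cvg0P; apply: (squeeze_cvgr _ (cvg_cst 0) cv).
  apply: nearW => n; rewrite normr_ge0 /=.
  by have := H n.+1%:R; rewrite normr_nat ltr0n; apply.
apply/norm_cvg0P; apply: (squeeze_cvgr _ (cvg_cst 0) cv).
apply: nearW => n; rewrite normr_ge0 /=.
by have := H (- n.+1%:R); rewrite normrN normr_nat ltr0n; apply.
Qed.

(** The integrand times the normal density is the derivative of [- p] times that density; the
    fundamental theorem of calculus on [[-n, n]] and dominated convergence conclude. Consequently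
    [X - D] is the adjoint of [D], which yields the orthogonality of the Hermite polynomials. *)
Lemma integral_gauss_ibp p :
  (\int[gauss]_x (('X * p - p^`()).[x])%:E = 0)%E.
Proof.
set q := 'X * p - _; rewrite integral_gauss; last exact: measurable_horner.
pose g x := q.[x] * normal_pdf 0 1 x.
pose F x := - (p.[x] * normal_pdf 0 1 x).
have dpdf x : is_derive x (1:R) (normal_pdf 0 1 : R -> R) (- x * normal_pdf 0 1 x).
  rewrite (_ : normal_pdf 0 1 = fun y : R => normal_peak 1 *: expR (- (y ^+ 2 / 2))); last first.
    by apply/funext => y; rewrite normal_pdf01E.
  have h := is_derive_gaussian x.
  by apply: is_derive_eq; rewrite /GRing.scale/=; ring.
have dF x : is_derive x (1:R) F (g x).
  have h := dpdf x; have h2 := is_derive_poly p x.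
  have h3 := is_deriveN (is_deriveM h2 h).
  apply: is_derive_eq; rewrite /g /q !hornerE.
  have sE (u v : R) : u *: (v : R^o) = u * v by [].
  by rewrite !sE; ring.
have cg : continuous g.
  move=> x; apply: cvgM; first exact: continuous_horner.
  by apply: continuous_normal_pdf; rewrite oner_neq0.
have cF : continuous F.
  by move=> x; apply: differentiable_continuous; apply/derivable1_diffP; apply: ex_derive.
have ig : mu.-integrable [set: R] (EFin \o g).
  apply/integrableP; split.
    apply/measurable_EFinP; exact: continuous_measurable_fun.
  have /integrableP[_] := integrable_horner q.
  rewrite ge0_integral_gauss//; last first.
    by apply: measurableT_comp => //; apply/measurable_EFinP; exact: measurable_horner.
  under eq_integral do rewrite -[(normal_pdf _ _ _)%:E]gee0_abs ?lee_fin ?normal_pdf_ge0// -abseM.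
  by [].
pose gn n x := g x * \1_(`[- n%:R, n%:R]%classic : set R) x.
have lim1 : (\int[mu]_x (gn n x)%:E)%E @[n --> \oo] --> (\int[mu]_x (g x)%:E)%E.
  apply: (@dominated_cvg _ _ _ mu setT measurableT (fun n x => (gn n x)%:E) _ (fun x => `|(g x)%:E|%E)) => //.
  - move=> n; apply/measurable_EFinP; apply: measurable_funM.
      exact: continuous_measurable_fun.
    exact: measurable_indic.
  - move=> x _; apply/fine_cvgP; split; first exact: nearW.
    apply: cvg_near_cst; near=> n.
    rewrite /= /gn indicE mem_set ?mulr1//= in_itv /= -ler_norml.
    near: n; exact: nbhs_infty_ger.
  - exact: integrable_abse.
  - move=> n x _; rewrite /gn lee_fin normrM ler_piMr// indicE.
    by case: (_ \in _); rewrite ?normr1 ?normr0.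
have lim2 : (\int[mu]_x (gn n x)%:E)%E @[n --> \oo] --> (0%:E : \bar R).
  rewrite -(@cvg_shiftS _ _ _).
  have FTC n : (\int[mu]_x (gn n.+1 x)%:E = (F n.+1%:R - F (- n.+1%:R))%:E)%E.
    rewrite EFinB -(@continuous_FTC2 _ g F).
    - rewrite [RHS]integral_mkcond; apply: eq_integral => x _.
      by rewrite /gn patchE indicE; case: (_ \in _); rewrite ?mulr1 ?mulr0.
    - by apply: (@lt_trans _ _ 0); rewrite ?oppr_lt0 ltr0n.
    - exact: continuous_subspaceT.
    - split.
      + by move=> x _; apply: ex_derive.
      + by apply: cvg_at_right_filter; exact: cF.
      + by apply: cvg_at_left_filter; exact: cF.
    - by move=> x _; rewrite derive1E derive_val.
  rewrite (_ : [sequence _]_n = EFin \o (fun n => F n.+1%:R - F (- n.+1%:R))); last first.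
    by apply/funext => n; rewrite /= FTC.
  apply: cvg_EFin; first exact: nearW.
  rewrite [X in _ --> X](_ : 0 = - 0 - - 0); last by rewrite oppr0 subr0.
  have [c1 c2] := poly_gaussian_cvg0 p.
  rewrite -(@cvg_shiftS _ _ _) in c1; rewrite -(@cvg_shiftS _ _ _) in c2.
  by apply: cvgB; apply: cvgN.
exact: (cvg_unique _ lim1 lim2).
Unshelve. all: by end_near. Qed.

(** Both sides are the joint density of [X] and [Z = aX + bY] for independent standard normal [X]
    and [Y], conditioned on either coordinate: given [Z = z], [X] is normal of mean [a z] and
    variance [b^2]. *)
Lemma normal_pdf_swap a b x z : a ^+ 2 + b ^+ 2 = 1 -> b != 0 ->
  normal_pdf (a * x) b z * normal_pdf 0 1 x =
  normal_pdf 0 1 z * normal_pdf (a * z) b x.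
Proof.
move=> ab b0; rewrite !normal_pdf01E !normal_pdfE// /normal_fun.
rewrite mulrACA [RHS]mulrACA (mulrC (normal_peak 1)); congr (_ * _).
rewrite -!expRD; congr expR.
have hb : b ^+ 2 = 1 - a ^+ 2 by rewrite -ab addrAC subrr add0r.
have -> : (z - a * x) ^+ 2 = b ^+ 2 * z ^+ 2 + (x - a * z) ^+ 2 - b ^+ 2 * x ^+ 2.
  by rewrite hb; ring.
by field.
Qed.

Lemma normal_pdf_affine b c y : 0 < b ->
  normal_pdf 0 1 y = b * normal_pdf c b (c + b * y).
Proof.
move=> b0; rewrite normal_pdf01E normal_pdfE ?gt_eqF// /normal_fun /normal_peak.
rewrite mulrA addrAC subrr add0r; congr (_ * expR _); last first.
  by field; rewrite gt_eqF.
rewrite expr1n mul1r -mulrnAr sqrtrM ?sqr_ge0// sqrtr_sqr gtr0_norm//.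
by rewrite invfM mulVKf ?gt_eqF.
Qed.

(** Substitute [z = a x + b y] in the inner integral, exchange the roles of the two densities, and
    integrate out [x]: what remains in [x] is a normal density of mass 1. *)
Lemma ge0_integral_gauss_rotation a b (q : R -> \bar R) :
  a ^+ 2 + b ^+ 2 = 1 -> 0 < b ->
  measurable_fun [set: R] q -> (forall x, 0 <= q x)%E ->
  (\int[gauss]_x \int[gauss]_y q (a * x + b * y)%R = \int[gauss]_z q z)%E.
Proof.
move=> ab b0 mq q0.
have inner x : (\int[gauss]_y q (a * x + b * y)%R =
    \int[mu]_z (q z * (normal_pdf (a * x) b z)%:E))%E.
  have mF : measurable_fun [set: R] (fun y : R => a * x + b * y).
    by apply: measurable_funD => //; exact: measurable_funM.
  have mqF : measurable_fun [set: R] (fun y => q (a * x + b * y)).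
    exact: measurableT_comp mq mF.
  have mpdf : measurable_fun [set: R] (fun z => (normal_pdf (a * x) b z)%:E).
    by apply/measurable_EFinP; exact: measurable_normal_pdf.
  have mpdfF : measurable_fun [set: R] (fun y => (normal_pdf (a * x) b (a * x + b * y))%:E).
    exact: measurableT_comp mpdf mF.
  have pdf_ge0 z : (0 <= q z * (normal_pdf (a * x) b z)%:E)%E.
    by rewrite mule_ge0// lee_fin normal_pdf_ge0.
  have mpqF : measurable_fun [set: R]
      (fun y => q (a * x + b * y)%R * (normal_pdf (a * x) b (a * x + b * y))%:E)%E.
    exact: emeasurable_funM.
  transitivity (\int[mu]_y (q (a * x + b * y)%R * (normal_pdf 0 1 y)%:E))%E.
    exact: ge0_integral_gauss.
  rewrite (ge0_integral_affine (a * x) b0 (emeasurable_funM mq mpdf) pdf_ge0).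
  rewrite -ge0_integralZl ?lee_fin ?(ltW b0)//.
  by apply: eq_integral => y _; rewrite (normal_pdf_affine (a * x) y b0) muleCA -EFinM.
under eq_integral do rewrite inner.
pose G (xz : measurableTypeR R * measurableTypeR R) : \bar R :=
  (q xz.2 * (normal_pdf (a * xz.1) b xz.2)%:E * (normal_pdf 0 1 xz.1)%:E)%E.
have mG' : measurable_fun [set: measurableTypeR R * measurableTypeR R]
    (fun xz : measurableTypeR R * measurableTypeR R =>
      q xz.2 * (normal_pdf (a * xz.1) b xz.2)%:E)%E.
  apply: emeasurable_funM.
  - by apply: measurableT_comp => //; exact: measurable_snd.
  - apply/measurable_EFinP; rewrite /normal_pdf gt_eqF//.
    apply: measurable_funM => //; apply: measurableT_comp => //.
    apply: measurable_funM => //; apply: measurableT_comp => //.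
    apply: measurable_funX; apply: measurable_funB => //.
    by apply: measurable_funM => //; exact: measurable_fst.
have mG : measurable_fun [set: measurableTypeR R * measurableTypeR R] G.
  apply: emeasurable_funM => //.
  apply/measurable_EFinP; apply: measurableT_comp; last exact: measurable_fst.
  exact: measurable_normal_pdf.
have G0 xz : (0 <= G xz)%E by rewrite /G !mule_ge0// lee_fin normal_pdf_ge0.
transitivity (\int[mu]_x \int[mu]_z G (x, z))%E.
  transitivity (\int[mu]_x ((\int[mu]_z (q z * (normal_pdf (a * x) b z)%:E)) *
     (normal_pdf 0 1 x)%:E))%E.
    apply: ge0_integral_gauss; last first.
      by move=> x; apply: integral_ge0 => y _; rewrite mule_ge0// lee_fin normal_pdf_ge0.
    have := @measurable_fun_fubini_tonelli_F _ _ _ _ _ mu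
      (fun xz : measurableTypeR R * measurableTypeR R => q xz.2 * (normal_pdf (a * xz.1) b xz.2)%:E)%E.
    apply.
    + exact: mG'.
    + by move=> xz; rewrite mule_ge0// lee_fin normal_pdf_ge0.
  - apply: eq_integral => x _; rewrite -ge0_integralZr ?lee_fin ?normal_pdf_ge0//.
    + apply: emeasurable_funM => //.
      by apply/measurable_EFinP; exact: measurable_normal_pdf.
    + by move=> y _; rewrite mule_ge0// lee_fin normal_pdf_ge0.
rewrite (@fubini_tonelli _ _ _ _ _ mu mu G)//.
transitivity (\int[mu]_z (q z * (normal_pdf 0 1 z)%:E))%E; last first.
  by apply/esym; exact: ge0_integral_gauss.
apply: eq_integral => z _; rewrite /G /=.
transitivity (\int[mu]_x (q z * (normal_pdf 0 1 z)%:E * (normal_pdf (a * z) b x)%:E))%E.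
  apply: eq_integral => x _; rewrite -!muleA -!EFinM normal_pdf_swap ?gt_eqF//.
rewrite ge0_integralZl ?mule_ge0 ?lee_fin ?normal_pdf_ge0//.
- by rewrite integral_normal_pdf mule1.
- by apply/measurable_EFinP; exact: measurable_normal_pdf.
- by move=> x _; rewrite lee_fin normal_pdf_ge0.
Qed.

End gaussian.

(** * Density of the polynomials in L^2 *)

Import HBNNSimple.

Section polynomial_density.
Context {R : realType}.
Implicit Types (p : {poly R}) (q u v : R -> R).
Local Notation gaussR := (@gauss R).

(** Extended-real, so that it can be taken of functions not yet known to be square integrable. *)
Definition sqnorm u : \bar R := (\int[gauss]_x (u x ^+ 2)%:E)%E.

Lemma sqnorm_ge0 u : (0 <= sqnorm u)%E.
Proof. by apply: integral_ge0 => x _; rewrite lee_fin sqr_ge0. Qed.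

Let msqr u : measurable_fun [set: R] u ->
  measurable_fun [set: R] (fun x => (u x ^+ 2)%:E).
Proof. by move=> mu; apply/measurable_EFinP; exact: measurable_funX. Qed.

Lemma sqnormD u v : measurable_fun [set: R] u -> measurable_fun [set: R] v ->
  (sqnorm (u \+ v)%R <= 2%:E * sqnorm u + 2%:E * sqnorm v)%E.
Proof.
move=> mu mv; rewrite /sqnorm -!ge0_integralZl//.
- rewrite -ge0_integralD//.
  + apply: ge0_le_integral => //.
    * by move=> x _; rewrite lee_fin sqr_ge0.
    * by apply: msqr; exact: measurable_funD.
    * by apply: emeasurable_funD; apply: measurable_funeM; exact: msqr.
    * move=> x _; rewrite -!EFinM -EFinD lee_fin /=.
      by have := sqr_ge0 (u x - v x); nra.
  + by move=> x _; rewrite -EFinM lee_fin mulr_ge0// sqr_ge0.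
  + by apply: measurable_funeM; exact: msqr.
  + by move=> x _; rewrite -EFinM lee_fin mulr_ge0// sqr_ge0.
  + by apply: measurable_funeM; exact: msqr.
- exact: msqr.
- by move=> x _; rewrite lee_fin sqr_ge0.
- exact: msqr.
- by move=> x _; rewrite lee_fin sqr_ge0.
Qed.

Lemma sqnormZ_le u v (B : R) : measurable_fun [set: R] u ->
  measurable_fun [set: R] v -> 0 <= B -> (forall x, `|v x| <= B * `|u x|) ->
  (sqnorm v <= (B ^+ 2)%:E * sqnorm u)%E.
Proof.
move=> mu mv B0 vu; rewrite /sqnorm -ge0_integralZl ?lee_fin ?sqr_ge0//.
- apply: ge0_le_integral => //.
  + by move=> x _; rewrite lee_fin sqr_ge0.
  + exact: msqr.
  + by apply: measurable_funeM; exact: msqr.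
  + move=> x _; rewrite -EFinM lee_fin -exprMn -(real_normK (num_real (v x))).
    rewrite -(real_normK (num_real (B * u x))) lerXn2r ?nnegrE//.
    by rewrite normrM (ger0_norm B0).
- exact: msqr.
- by move=> x _; rewrite lee_fin sqr_ge0.
Qed.

Definition poly_approx q := measurable_fun [set: R] q /\
  forall e : R, 0 < e ->
    exists p, (sqnorm (fun x => q x - p.[x])%R < e%:E)%E.

Lemma poly_approx_horner p : poly_approx (horner p).
Proof.
split; first exact: measurable_horner.
move=> e e0; exists p; rewrite /sqnorm.
by under eq_integral do rewrite subrr expr0n; rewrite integral0 lte_fin.
Qed.

Lemma poly_approx_closed q : measurable_fun [set: R] q ->
  (forall e : R, 0 < e -> exists2 q', poly_approx q' &
    (sqnorm (fun x => q x - q' x)%R < e%:E)%E) -> poly_approx q.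
Proof.
move=> mq H; split=> // e e0.
have e4 : 0 < e / 4 by rewrite divr_gt0.
have [q' [mq' aq'] qq'] := H _ e4.
have [p q'p] := aq' _ e4; exists p.
have -> : (fun x => q x - p.[x]) = ((fun x => q x - q' x) \+ (fun x => q' x - p.[x])).
  by apply/funext => x /=; rewrite addrA subrK.
apply: le_lt_trans (sqnormD _ _) _.
- exact: measurable_funB.
- by apply: measurable_funB => //; exact: measurable_horner.
have -> : e%:E = (2%:E * (e / 4)%:E + 2%:E * (e / 4)%:E)%E.
  by rewrite -!EFinM -EFinD; congr EFin; field.
by apply: lteD; rewrite lte_pmul2l// ?fin_numE ?lte_fin.
Qed.

(** Dominated convergence applied to the squared errors, of which [G] is an integrable bound. *)
Lemma poly_approx_lim (q_ : nat -> R -> R) q (G : R -> R) :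
  (forall n, poly_approx (q_ n)) -> measurable_fun [set: R] q ->
  gaussR.-integrable [set: R] (EFin \o G) ->
  (forall n x, (q x - q_ n x) ^+ 2 <= G x) ->
  (forall x, q_ n x @[n --> \oo] --> q x) -> poly_approx q.
Proof.
move=> aq_ mq iG qG q_q; apply: poly_approx_closed => // e e0.
have : (sqnorm (fun x => q x - q_ n x)%R) @[n --> \oo] --> (\int[gauss]_x (cst 0%E x : \bar R))%E.
  apply: (@dominated_cvg _ _ _ gaussR setT measurableT
    (fun n x => ((q x - q_ n x) ^+ 2)%:E) (cst 0%E) (EFin \o G)) => //.
  - by move=> n; apply: msqr; apply: measurable_funB => //; exact: (aq_ n).1.
  - move=> x _; apply: cvg_EFin; first exact: nearW.
    rewrite [X in _ --> X](_ : _ = (q x - q x) ^+ 2); last by rewrite subrr expr0n.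
    apply: (@cvg_comp _ _ _ (fun n => q x - q_ n x) (fun y => y ^+ 2)).
      by apply: cvgB; [exact: cvg_cst|exact: q_q].
    exact: exprn_continuous.
  - by move=> n x _; rewrite gee0_abs ?lee_fin ?sqr_ge0//= qG.
rewrite integral0 => /fine_cvgP[fin /cvgrPdist_lt/(_ _ e0) near_e].
have [n [fn en]] : exists n, sqnorm (fun x => q x - q_ n x) \is a fin_num /\
    `|0 - fine (sqnorm (fun x => q x - q_ n x))| < e.
  by have [n _ nP] := filterI fin near_e; exists n; exact: (nP n (leqnn n)).
exists (q_ n) => //; move: en; rewrite sub0r normrN -lte_fin => en.
rewrite -(fineK fn); apply: le_lt_trans en.
by rewrite lee_fin ler_norm.
Qed.

Lemma poly_approxD q u : poly_approx q -> poly_approx u -> poly_approx (q \+ u).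
Proof.
move=> [mq aq] [mu au]; split; first exact: measurable_funD.
move=> e e0; have e4 : 0 < e / 4 by rewrite divr_gt0.
have [p qp] := aq _ e4; have [p' up'] := au _ e4; exists (p + p').
have -> : (fun x => (q \+ u) x - (p + p').[x]) =
    ((fun x => q x - p.[x]) \+ (fun x => u x - p'.[x])).
  by apply/funext => x /=; rewrite hornerD opprD addrACA.
apply: le_lt_trans (sqnormD _ _) _.
- by apply: measurable_funB => //; exact: measurable_horner.
- by apply: measurable_funB => //; exact: measurable_horner.
have -> : e%:E = (2%:E * (e / 4)%:E + 2%:E * (e / 4)%:E)%E.
  by rewrite -!EFinM -EFinD; congr EFin; field.
by apply: lteD; rewrite lte_pmul2l// ?fin_numE ?lte_fin.
Qed.

(* Unlike [poly_approx], this is stable under products and under bounded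
   pointwise limits, so a monotone class argument applies to it. *)
Definition multiplier q := [/\ measurable_fun [set: R] q,
  exists B : R, forall x, `|q x| <= B &
  forall p, poly_approx (fun x => q x * p.[x])].

Lemma multiplier_cst (c : R) : multiplier (cst c).
Proof.
split.
- exact: measurable_cst.
- by exists `|c|.
move=> p; rewrite [X in poly_approx X](_ : _ = horner (c *: p)).
  exact: poly_approx_horner.
by apply/funext => x; rewrite hornerZ.
Qed.

Lemma multiplierD q u : multiplier q -> multiplier u -> multiplier (q \+ u).
Proof.
move=> [mq [B qB] aq] [mu [B' uB'] au]; split.
- exact: measurable_funD.
- by exists (B + B') => x /=; rewrite (le_trans (ler_normD _ _))// lerD.
- move=> p; rewrite [X in poly_approx X](_ : _ = (fun x => q x * p.[x]) \+ (fun x => u x * p.[x])).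
    exact: poly_approxD.
  by apply/funext => x /=; rewrite mulrDl.
Qed.

(** Approximate [u p] by a polynomial [p']: then [q p'] is approximable because [q] is a multiplier,
    and the bound on [q] controls [q (u p - p')]. *)
Lemma multiplierM q u : multiplier q -> multiplier u -> multiplier (q \* u).
Proof.
move=> [mq [B qB] aq] [mu [B' uB'] au]; split.
- exact: measurable_funM.
- by exists (B * B') => x /=; rewrite normrM ler_pM.
move=> p; apply: poly_approx_closed.
  by apply: measurable_funM; [exact: measurable_funM|exact: measurable_horner].
move=> e e0; have [mup aup] := au p.
(* A bound on [q] by which one may divide. *)
have B1 : 0 < `|B| + 1 by rewrite ltr_wpDl.
have eB : 0 < e / (`|B| + 1) ^+ 2 by rewrite divr_gt0// exprn_gt0.
have [p' pp'] := aup _ eB.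
exists (fun x => q x * p'.[x]); first exact: aq.
have mup' : measurable_fun [set: R] (fun x => u x * p.[x] - p'.[x]).
  by apply: measurable_funB => //; exact: measurable_horner.
apply: (@le_lt_trans _ _ (((`|B| + 1) ^+ 2)%:E * sqnorm (fun x => u x * p.[x] - p'.[x])%R)%E).
  apply: sqnormZ_le => //.
  - apply: measurable_funB; last by apply: measurable_funM => //; exact: measurable_horner.
    by apply: measurable_funM; [exact: measurable_funM|exact: measurable_horner].
  - move=> x; rewrite /= -mulrA -mulrBr normrM ler_wpM2r//.
    by rewrite (le_trans (qB x))// (le_trans (ler_norm _))// lerDl.
have -> : e%:E = (((`|B| + 1) ^+ 2)%:E * (e / (`|B| + 1) ^+ 2)%:E)%E.
  by rewrite -EFinM mulrCA divff ?mulr1// expf_neq0// gt_eqF.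
by rewrite lte_pmul2l// ?fin_numE ?lte_fin ?exprn_gt0.
Qed.

Lemma multiplier_lim (q_ : nat -> R -> R) q (B : R) :
  (forall n, multiplier (q_ n)) -> (forall n x, `|q_ n x| <= B) ->
  (forall x, q_ n x @[n --> \oo] --> q x) -> multiplier q.
Proof.
move=> mq_ q_B q_q.
have qB x : `|q x| <= B.
  have h : `|q_ n x| @[n --> \oo] --> `|q x| by apply: cvg_norm; exact: q_q.
  rewrite -(cvg_lim (@Rhausdorff R) h); apply: limr_le; first by apply: cvgP h.
  exact: nearW.
have mq : measurable_fun [set: R] q.
  apply: (@measurable_fun_cvg _ _ _ _ q_) => [n|x _]; last exact: q_q.
  by have [] := mq_ n.
split => //; first by exists B.
move=> p; apply: (@poly_approx_lim (fun n x => q_ n x * p.[x]) _ (horner ((2 * B) ^+ 2 *: p ^+ 2))).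
- by move=> n; have [_ _] := mq_ n; exact.
- by apply: measurable_funM => //; exact: measurable_horner.
- exact: integrable_horner.
- move=> n x; rewrite -mulrBl exprMn hornerZ horner_exp ler_wpM2r ?sqr_ge0//.
  rewrite -(real_normK (num_real (q x - q_ n x))) lerXn2r ?nnegrE//.
    by rewrite mulr_ge0// (le_trans _ (qB x)).
  by rewrite (le_trans (ler_normB _ _))// mulr_natl mulr2n lerD.
- by move=> x; apply: cvgM; [exact: q_q|exact: cvg_cst].
Qed.

Lemma multiplier_sum (I : Type) (s : seq I) (q_ : I -> R -> R) :
  (forall i, multiplier (q_ i)) -> multiplier (fun x => \sum_(i <- s) q_ i x).
Proof.
move=> mq_; elim: s => [|i s IH].
  rewrite (_ : (fun _ => _) = cst 0); first exact: multiplier_cst.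
  by apply/funext => x; rewrite big_nil.
rewrite (_ : (fun _ => _) = q_ i \+ (fun x => \sum_(i <- s) q_ i x)).
  exact: multiplierD.
by apply/funext => x; rewrite big_cons.
Qed.

Lemma multiplierX q n : multiplier q -> multiplier (fun x => q x ^+ n).
Proof.
move=> mq; elim: n => [|n IH]; first exact: multiplier_cst.
rewrite (_ : (fun _ => _) = q \* (fun x => q x ^+ n)); first exact: multiplierM.
by apply/funext => x; rewrite exprS.
Qed.

Lemma series_exp_coeff_le (x : R) n : 0 <= x -> series (exp_coeff x) n <= expR x.
Proof.
move=> x0; rewrite /expR; apply: nondecreasing_cvgn_le.
  apply: nondecreasing_series => i _ _; exact: exp_coeff_ge0.
exact: is_cvg_series_exp_coeff.
Qed.

(** The partial sums of the exponential series are polynomials in [q], bounded by [exp B] whatever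
    their degree. *)
Lemma multiplier_exp q : multiplier q -> multiplier (expR \o q).
Proof.
move=> mq; have [_ [B qB] _] := mq.
apply: (@multiplier_lim (fun n x => series (exp_coeff (q x)) n) _ (expR B)).
- move=> n; rewrite /series /=; apply: multiplier_sum => i.
  rewrite /exp_coeff /= (_ : (fun _ => _) = (fun x => q x ^+ i) \* cst (i`!%:R^-1)) //.
  by apply: multiplierM; [exact: multiplierX|exact: multiplier_cst].
- move=> n x; apply: (@le_trans _ _ (series (exp_coeff `|q x|) n)).
    rewrite /series /=; apply: le_trans (ler_norm_sum _ _ _) _.
    by apply: ler_sum => i _; rewrite /exp_coeff /= normrM normrX [X in _ * X]ger0_norm ?invr_ge0.
  by rewrite (le_trans (series_exp_coeff_le _ _))// ler_expR.
- by move=> x; exact: is_cvg_series_exp_coeff.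
Qed.

(** The bounded non-constant function from which all others are built. Its Taylor polynomials are
    dominated by [exp |e (x - m)|] uniformly in the degree, and the exponential moments of the
    Gaussian measure make this a square-integrable bound even after multiplication by [p]. *)
Lemma multiplier_sin (e m : R) : multiplier (fun x => sin (e * (x - m))).
Proof.
have sin1 y : `|sin y| <= 1 :> R by rewrite ler_norml sin_geN1 sin_le1.
have msin : measurable_fun [set: R] (fun x => sin (e * (x - m))).
  apply: measurableT_comp; first by apply: continuous_measurable_fun; exact: continuous_sin.
  by apply: measurable_funM => //; exact: measurable_funB.
split => //; first by exists 1.
move=> p; have [C C0 pC] := horner_bound p.
pose c k : R := (odd k)%:R * (-1) ^+ k.-1./2 / k`!%:R.
pose S n : {poly R} := \sum_(0 <= k < n) c k *: (e *: ('X - m%:P)) ^+ k.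
have SE n x : (S n).[x] = series (sin_coeff (e * (x - m))) n.
  rewrite /S horner_sum /series /=; apply: eq_bigr => k _.
  by rewrite hornerZ horner_exp hornerZ hornerXsubC /sin_coeff /= /c mulrAC.
have Sle n x : `|(S n).[x]| <= expR `|e * (x - m)|.
  rewrite SE; apply: (@le_trans _ _ (series (exp_coeff `|e * (x - m)|) n)); last exact: series_exp_coeff_le.
  rewrite /series /=; apply: le_trans (ler_norm_sum _ _ _) _.
  apply: ler_sum => i _; rewrite /exp_coeff /sin_coeff /= !normrM !normrX normfV !normr_nat normrN1 expr1n mulr1 normrM.
  rewrite ler_wpM2r ?invr_ge0// ler_piMl ?exprn_ge0 ?mulr_ge0//.
  by rewrite lern1 leq_b1.
(* The square of twice the bound [exp(|e||x| + |e||m|)], common to the sine and its Taylor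
   polynomials, times the bound [C exp |x|] of [p]. *)
pose G (x : R) : R := (2 * expR (`|e| * `|m|) * C) ^+ 2 * expR ((2 * `|e| + 2) * `|x|).
apply: (@poly_approx_lim (fun n => horner (S n * p)) _ G).
- by move=> n; exact: poly_approx_horner.
- by apply: measurable_funM => //; exact: measurable_horner.
- exact: (integrableZl measurableT _ (integrable_expR_norm _)).
- move=> n x.
  have -> : G x = (2 * expR (`|e| * `|x| + `|e| * `|m|) * (C * expR `|x|)) ^+ 2.
    rewrite /G expRD (_ : expR ((2 * `|e| + 2) * `|x|) = (expR (`|e| * `|x|) * expR `|x|) ^+ 2); first by ring.
    by rewrite -expRD -expRM_natl; congr expR; ring.
  rewrite -(real_normK (num_real (_ - _))) lerXn2r ?nnegrE ?mulr_ge0 ?expR_ge0//.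
  rewrite hornerM -mulrBl normrM ler_pM//.
  have E1 : expR `|e * (x - m)| <= expR (`|e| * `|x| + `|e| * `|m|).
    by rewrite ler_expR normrM -mulrDr ler_wpM2l// ler_normB.
  rewrite (le_trans (ler_normB _ _))// mulr_natl mulr2n lerD//.
    by rewrite (le_trans (sin1 _))// (le_trans _ E1)// -expR0 ler_expR.
  exact: le_trans (Sle _ _) E1.
- move=> x; under eq_cvg do rewrite hornerM SE.
  apply: cvgM; last exact: cvg_cst.
  rewrite unlock; exact: is_cvg_series_sin_coeff.
Qed.

(* With [s = sin (e * (x - m))] and [e] tending to 0, this turns the analytic
   multipliers of [multiplier_sin] into the indicator of a ray. *)
Lemma cvg_double_exp (s : R) :
  expR (- (n%:R * expR (- (n%:R * s)))) @[n --> \oo] --> ((0 < s)%R%:R : R).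
Proof.
have [s0|s0] := ltP 0 s; last first.
  apply: (squeeze_cvgr _ (cvg_cst 0) (@cvgn_expR R)).
  apply: nearW => n; rewrite expR_ge0 ler_expR lerN2 ler_peMr//.
  by rewrite -expR0 ler_expR oppr_ge0 mulr_ge0_le0.
have -> : (true%:R : R) = expR 0 by rewrite expR0.
rewrite -(@cvg_shiftS _ _ _).
apply: (@cvg_comp _ _ _ (fun n : nat => - (n.+1%:R * expR (- (n.+1%:R * s)))) expR); last exact: continuous_expR.
rewrite -oppr0; apply: cvgN.
(* [exp x >= 1 + x^2/2] gives [n exp(- n s) <= 2 / (s^2 n)]. *)
have cv : 2 / s ^+ 2 * n.+1%:R^-1 @[n --> \oo] --> (0 : R).
  rewrite -[X in _ --> X](mulr0 (2 / s ^+ 2)).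
  by apply: cvgM; [exact: cvg_cst|exact: cvg_harmonic].
apply: (squeeze_cvgr _ (cvg_cst 0) cv); apply: nearW => n.
rewrite mulr_ge0 ?expR_ge0//= expRN ler_pdivrMr ?expR_gt0//.
have ns0 : 0 <= n.+1%:R * s by rewrite mulr_ge0// ltW.
apply: le_trans (ler_wpM2l _ (expR_ge1Dxn 1 ns0)); last first.
  by rewrite mulr_ge0 ?invr_ge0// divr_ge0// sqr_ge0.
rewrite [leRHS](_ : _ = 2 / s ^+ 2 / n.+1%:R + n.+1%:R); last first.
  rewrite (_ : 2`! = 2)%N//.
  have : n.+1%:R != 0 :> R by rewrite pnatr_eq0.
  by move: n.+1%:R => N N0; field; rewrite N0 gt_eqF.
by rewrite lerDr mulr_ge0 ?invr_ge0// divr_ge0// sqr_ge0.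
Qed.

Lemma multiplier_ray (m : R) : multiplier (\1_(`]m, +oo[%classic : set R)).
Proof.
pose s k x := sin (k.+1%:R^-1 * (x - m)).
apply: (@multiplier_lim (fun k x => ((0 < s k x)%R%:R : R)) _ 1).
- move=> k; apply: (@multiplier_lim (fun n x => expR (- (n%:R * expR (- (n%:R * s k x))))) _ 1).
  + move=> n; rewrite (_ : (fun _ => _) = expR \o (cst (- n%:R) \* (expR \o (cst (- n%:R) \* s k)))); last first.
      by apply/funext => x /=; rewrite !mulNr.
    apply: multiplier_exp; apply: multiplierM; first exact: multiplier_cst.
    apply: multiplier_exp; apply: multiplierM; first exact: multiplier_cst.
    exact: multiplier_sin.
  + move=> n x; rewrite ger0_norm ?expR_ge0// -expR0 ler_expR oppr_le0 mulr_ge0.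
  + by move=> x; exact: cvg_double_exp.
- by move=> k x; case: (_ < _); rewrite ?normr1 ?normr0.
- move=> x; apply: cvg_near_cst; near=> k.
  (* As soon as [k > |x - m| / pi], the argument lies in []-pi, pi[], where the sine has the sign of
     its argument. *)
  have small : `|k.+1%:R^-1 * (x - m)| < pi :> R.
    rewrite normrM ger0_norm ?invr_ge0// mulrC ltr_pdivrMr// mulrC -ltr_pdivrMr ?pi_gt0//.
    rewrite (@lt_trans _ _ k%:R) ?ltr_nat//.
    by near: k; exact: nbhs_infty_gtr.
  rewrite indicE; congr (nat_of_bool _)%:R; apply/idP/idP.
    rewrite /s => H; rewrite mem_set//= in_itv /= andbT ltNge; apply/negP => xm.
    move: H; apply/negP; rewrite -leNgt -[_ * _]opprK sinN oppr_le0.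
    apply: sin_ge0_pi; rewrite -mulrN opprB mulr_ge0 ?invr_ge0 ?subr_ge0//=.
    by rewrite -(opprB x) mulrN ltW// (le_lt_trans _ small)// -normrN ler_norm.
  rewrite inE /= in_itv /= andbT => mx; apply: sin_gt0_pi.
  by rewrite mulr_gt0 ?invr_gt0 ?subr_gt0//= (le_lt_trans (ler_norm _) small).
Unshelve. all: by end_near. Qed.

(** Stability under products, sums and bounded pointwise limits makes the sets whose indicator is a
    multiplier a sigma-algebra; it contains the rays, which generate the measurable sets. *)
Lemma multiplier_indic (A : set R) : measurable A -> multiplier (\1_A).
Proof.
move=> mA; have : (@RGenOInfty.G R).-sigma.-measurable A by rewrite -RGenOInfty.measurableE.
move: A {mA}; apply: smallest_sub; last first.
  by move=> _ [m ->]; exact: multiplier_ray.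
have mC B : multiplier (\1_B : R -> R) -> multiplier (\1_(~` B) : R -> R).
  move=> mB; rewrite (_ : \1_(~` B) = cst 1 \+ (cst (-1) \* \1_B)).
    apply: multiplierD; first exact: multiplier_cst.
    by apply: multiplierM => //; exact: multiplier_cst.
  apply/funext => x /=; rewrite !indicE in_setC.
  by case: (_ \in _); rewrite /= ?mulr1 ?mulr0 ?addr0 ?subrr.
split.
- rewrite indic0; exact: multiplier_cst.
- by move=> B mB; rewrite setTD; exact: mC.
- move=> B_ mB_.
  have mU n : multiplier (\1_(\big[setU/set0]_(i < n) B_ i) : R -> R).
    elim: n => [|n IH]; first by rewrite big_ord0 indic0; exact: multiplier_cst.
    rewrite big_ord_recr /= -[X in \1_X]setCK setCU; apply: (mC _).
    rewrite (_ : \1_(_ `&` _) = \1_(~` \big[setU/set0]_(i < n) B_ i) \* \1_(~` B_ n)).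
      by apply: multiplierM; [exact: (mC _ IH)|exact: (mC _ (mB_ n))].
    by apply/funext => x; rewrite indicI.
  apply: (multiplier_lim mU (B := 1)).
    by move=> n x; rewrite indicE; case: (_ \in _); rewrite ?normr1 ?normr0.
  move=> x; apply: cvg_near_cst.
  rewrite !indicE; have [[k _ Bkx]|nB] := pselect ((\bigcup_k B_ k) x).
    have xU : (\bigcup_k B_ k) x by exists k.
    near=> n.
    have xn : (\big[setU/set0]_(i < n) B_ i) x.
      by rewrite -bigcup_mkord; exists k => //=; near: n; exact: nbhs_infty_gt.
    by rewrite indicE !mem_set.
  apply: nearW => n.
  have xn : ~ (\big[setU/set0]_(i < n) B_ i) x.
    by rewrite -bigcup_mkord => -[k _ Bkx]; apply: nB; exists k.
  by rewrite indicE !memNset.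
Unshelve. all: by end_near. Qed.

(** The nonnegative function [q + B] is a bounded limit of simple functions, which are combinations
    of indicators; hence [q] is a multiplier, and the polynomial 1 is the case that is used. *)
Lemma poly_approx_bounded q (B : R) : measurable_fun [set: R] q ->
  (forall x, `|q x| <= B) -> poly_approx q.
Proof.
move=> mq qB.
have mqB : measurable_fun [set: R] (fun x => (q x + B)%:E).
  by apply/measurable_EFinP; exact: measurable_funD.
have qB0 x : 0 <= q x + B.
  by have := qB x; rewrite ler_norml => /andP[+ _]; rewrite -subr_ge0 opprK.
pose h := nnsfun_approx measurableT mqB.
have mh n : multiplier (fun x => h n x).
  rewrite (_ : (fun x => h n x) = fun x => \sum_(y <- finmap.enum_fset (fset_set (range (h n)))) y * \1_(h n @^-1` [set y]) x).
    apply: multiplier_sum => y; apply: multiplierM; first exact: multiplier_cst.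
    exact: multiplier_indic.
  by apply/funext => x; rewrite fimfunE fsbig_finite.
have cvh x : h n x @[n --> \oo] --> q x + B.
  have := @cvg_nnsfun_approx _ _ _ _ measurableT _ mqB (fun x _ => qB0 x) x I.
  by move/fine_cvgP => [].
have hle n x : `|h n x| <= 2 * B.
  rewrite ger0_norm// (@le_trans _ _ (q x + B))//.
    rewrite -lee_fin nnsfun_approxE; apply: le_approx => // y _.
    by rewrite lee_fin.
  by rewrite mulr_natl mulr2n lerD2r (le_trans (ler_norm _)).
have mqB' : multiplier (fun x => q x + B) by apply: (multiplier_lim mh hle cvh).
have [_ _ /(_ 1)] := multiplierD mqB' (multiplier_cst (- B)).
rewrite (_ : (fun _ => _) = q)//.
by apply/funext => x /=; rewrite addrK hornerC mulr1.
Qed.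

End polynomial_density.

(** * The mixing matrix *)

Lemma monomial_le_1Dpow {R : realFieldType} (p q : nat) (b c u : R) :
  (p < q)%N -> 0 <= b -> 0 <= c -> 0 <= u -> (0 < b) || (p == 0%N) ->
  (c / q%:R) ^+ q * (p%:R / b) ^+ p <= 1 / (q - p)%:R ^+ (q - p) ->
  c * u ^+ p <= 1 + b * u ^+ q.
Proof.
move=> pq b0 c0 u0 bp H.
have q0 : 0 < q%:R :> R by rewrite ltr0n (leq_ltn_trans _ pq).
have m0 : 0 < (q - p)%:R :> R by rewrite ltr0n subn_gt0.
(* For [p = 0] the condition reads [(c/q)^q <= q^(-q)], that is [c <= 1]. *)
have [p0|p0] := posnP p.
  move: H; rewrite p0 expr0 mulr1 !subn0 expr_div_n div1r.
  rewrite ler_pdivrMr ?exprn_gt0// mulVf ?expf_neq0 ?gt_eqF// => cq.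
  have : c <= 1.
    by rewrite -(@ler_pXn2r _ q) ?expr1n ?nnegrE//; apply: leq_ltn_trans pq.
  by rewrite expr0 mulr1 => /le_trans; apply; rewrite lerDl mulr_ge0// exprn_ge0.
have b_gt0 : 0 < b by move: bp; rewrite (gtn_eqF p0) orbF.
pose E (i : 'I_q) : R := if (i < q - p)%N then (q - p)%:R^-1 else b * u ^+ q / p%:R.
have E0 : {in [pred _ : 'I_q | true], forall i, 0 <= E i}.
  move=> i _; rewrite /E; case: ifP => _; first by rewrite invr_ge0 ltW.
  by rewrite divr_ge0 ?mulr_ge0 ?exprn_ge0.
(* AM-GM for q - p copies of 1/(q-p) and p copies of b u^q / p. *)
have /leif_le := leif_AGM E0.
have cardI : #|[pred _ : 'I_q | true]| = q by rewrite -[RHS]card_ord; apply: eq_card.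
rewrite cardI.
have split_big op idx (x y : R) : \big[op/idx]_(i < q) (if (i < q - p)%N then x else y)
   = \big[op/idx]_(0 <= i < q) (if (i < q - p)%N then x else y).
  by rewrite big_mkord.
have -> : \sum_(i in [pred _ : 'I_q | true]) E i = 1 + b * u ^+ q.
  rewrite [LHS]split_big (@big_cat_nat _ _ _ (q - p)) ?leq_subr//=.
  rewrite (@eq_big_nat _ _ _ 0%N _ _ (fun=> (q - p)%:R^-1)); last first.
    by move=> i /andP[_ ->].
  rewrite (@eq_big_nat _ _ _ _ q _ (fun=> b * u ^+ q / p%:R)); last first.
    by move=> i /andP[/leq_gtF -> _].
  rewrite !sumr_const_nat subn0 subKn 1?ltnW//.
  rewrite -[_ *+ (q - p)]mulr_natr -[_ *+ p]mulr_natr mulVf ?gt_eqF//; congr (_ + _).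
  by rewrite divfK// pnatr_eq0 -lt0n.
have -> : \prod_(i in [pred _ : 'I_q | true]) E i =
    (q - p)%:R^-1 ^+ (q - p) * (b * u ^+ q / p%:R) ^+ p.
  rewrite [LHS]split_big (@big_cat_nat _ _ _ (q - p)) ?leq_subr//=.
  rewrite (@eq_big_nat _ _ _ 0%N _ _ (fun=> (q - p)%:R^-1)); last first.
    by move=> i /andP[_ ->].
  rewrite (@eq_big_nat _ _ _ _ q _ (fun=> b * u ^+ q / p%:R)); last first.
    by move=> i /andP[/leq_gtF -> _].
  by rewrite !prodr_const_nat subn0 subKn 1?ltnW.
move=> AGM.
have p_gt0 : 0 < p%:R :> R by rewrite ltr0n.
have pb0 : 0 < (p%:R / b) ^+ p by rewrite exprn_gt0// divr_gt0.
suff : (c * u ^+ p / q%:R) ^+ q <= ((1 + b * u ^+ q) / q%:R) ^+ q.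
  rewrite ler_pXn2r ?nnegrE ?(leq_ltn_trans _ pq)//.
  - by rewrite ler_pM2r// invr_gt0.
  - by rewrite divr_ge0// mulr_ge0// exprn_ge0.
  - by rewrite divr_ge0// addr_ge0// mulr_ge0// exprn_ge0.
apply: le_trans AGM; rewrite -(ler_pM2r pb0).
rewrite -[leRHS]mulrA -exprMn.
have -> : b * u ^+ q / p%:R * (p%:R / b) = u ^+ q.
  by field; rewrite !gt_eqF.
have -> : (c * u ^+ p / q%:R) ^+ q = (c / q%:R) ^+ q * (u ^+ q) ^+ p.
  by rewrite mulrAC exprMn -!exprM mulnC.
rewrite mulrAC ler_wpM2r ?exprn_ge0//.
by move: H; rewrite div1r -exprVn.
Qed.

Section weighted_cauchy_schwarz.
Context {R : realFieldType} {I : Type}.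
Implicit Types (s : seq I) (t x y : I -> R).

(** Taken over pairs of indices, with the entries of a nonnegative matrix as weights, this is the
    core of the Schur test. *)
Lemma weighted_cauchy_schwarz s t x y : (forall i, 0 <= t i) ->
  (\sum_(i <- s) t i * x i * y i) ^+ 2 <=
  (\sum_(i <- s) t i * x i ^+ 2) * (\sum_(i <- s) t i * y i ^+ 2).
Proof.
move=> t0; elim: s => [|i s IH]; first by rewrite !big_nil expr0n mul0r.
rewrite !big_cons.
set A := \sum_(j <- s) t j * x j ^+ 2 in IH *.
set B := \sum_(j <- s) t j * x j * y j in IH *.
set C := \sum_(j <- s) t j * y j ^+ 2 in IH *.
have A0 : 0 <= A by apply: sumr_ge0 => j _; rewrite mulr_ge0 ?sqr_ge0.
have C0 : 0 <= C by apply: sumr_ge0 => j _; rewrite mulr_ge0 ?sqr_ge0.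
(* By induction [B^2 <= A C], so the square of the left side is at most [4 (A y^2) (C x^2)], hence
   at most the square of the right side. *)
have cross : 2 * B * (x i * y i) <= A * y i ^+ 2 + C * x i ^+ 2.
  apply: le_trans (ler_norm _) _.
  have S0 : 0 <= A * y i ^+ 2 + C * x i ^+ 2.
    by apply: addr_ge0; apply: mulr_ge0 => //; exact: sqr_ge0.
  rewrite -(@ler_pXn2r _ 2) ?nnegrE//.
  rewrite real_normK ?num_real//.
  have H1 : B ^+ 2 * (x i * y i) ^+ 2 <= A * C * (x i * y i) ^+ 2.
    by rewrite ler_wpM2r ?sqr_ge0.
  have H2 : 0 <= (A * y i ^+ 2 - C * x i ^+ 2) ^+ 2 := sqr_ge0 _.
  nra.
have ti := t0 i.
have H3 : t i * (2 * B * (x i * y i)) <= t i * (A * y i ^+ 2 + C * x i ^+ 2).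
  by rewrite ler_wpM2l.
nra.
Qed.

End weighted_cauchy_schwarz.

(** * Row and column sums of the mixing matrix *)

Section mixed_hermite_sum.
Context {R : realType} (K N : nat) (c : nat -> R) (a : R).
Hypothesis K_gt0 : (0 < K)%N.
Hypothesis K_le_N : (K <= N)%N.
Hypothesis c_ge0 : forall k, 0 <= c k.

(* With [c k = |phi_k| / sqrt k!], [g k] is the gamma_k of hypothesis (H). *)
Let rho : R := 1 + N%:R / K%:R.
Let g k : R := Num.sqrt rho ^+ k * c k.
Let P (u : R) : R := 1 + \sum_(K <= k < N.+1) g k * u ^+ k.

Hypothesis g_H1 : forall k, (K <= k)%N -> (k + 2 <= N)%N ->
  (k + 2)%:R * g (k + 2) <= g k.
Hypothesis g_H2a : (K < N)%N -> forall u : R, 0 <= u ->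
  2 * (K + 1)%:R * g (K + 1) * u ^+ (K - 1) <= 1 + 2 * g N * u ^+ N.
Hypothesis g_H2a' : (K < N)%N -> forall u : R, 0 <= u ->
  2 * K%:R * g K * u ^+ (K - 1) <= u + 2 * g (N - 1) * u ^+ N.
Hypothesis g_H2b : K = N -> forall u : R, 0 <= u ->
  N%:R * g N * u ^+ (N - 1) <= u + g N * u ^+ (N + 1).

Let g_ge0 k : 0 <= g k.
Proof. by rewrite mulr_ge0// exprn_ge0// sqrtr_ge0. Qed.

(* This is P'(u) <= u P(u). *)
Lemma derivative_bound (u : R) : 0 <= u ->
  \sum_(K <= k < N.+1) k%:R * g k * u ^+ k.-1 <= u * P u.
Proof.
move=> u0; rewrite /P mulrDr mulr1.
move: K_le_N; rewrite leq_eqVlt => /predU1P[KN|KN].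
  rewrite -KN !big_nat1 KN.
  have := g_H2b KN u0; rewrite subn1 addn1 exprS.
  by rewrite (mulrCA (g N)).
have [M NM] : exists M, N = M.+1.
  by exists N.-1; rewrite prednK// (leq_ltn_trans _ KN).
have KM : (K <= M)%N by rewrite -ltnS -NM.
(* By (H1), each term of [P'] of index at least [K + 2] is absorbed by the term of [u P] of index
   smaller by 2. This leaves in [u P] the term [u] and those of index [N - 1] and [N]. The terms [K]
   and [K + 1] of [P'] take half of [u] each, together with the terms [N - 1] and [N] respectively;
   hence the factors 2 in (H2a). *)
have h1 := g_H2a KN u0; have h2 := g_H2a' KN u0.
rewrite big_ltn; last by rewrite ltnS ltnW.
rewrite big_ltn; last by rewrite ltnS.
rewrite -(addn2 K) big_addn subn2.
move: h1 h2; rewrite subn1 addn1 NM subn1 /= => h1 h2.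
have h1u : u * (2 * K.+1%:R * g K.+1 * u ^+ K.-1) <= u * (1 + 2 * g M.+1 * u ^+ M.+1).
  by rewrite ler_wpM2l.
have uK : u * u ^+ K.-1 = u ^+ K by rewrite -exprS prednK.
have uM : u ^+ M.+1 = u * u ^+ M by rewrite exprS.
rewrite !big_nat_recr//=; last by rewrite leqW.
have h3 : \sum_(K <= i < M) (i + 2)%:R * g (i + 2)%N * u ^+ (i + 2).-1 <=
    \sum_(K <= i < M) u * (g i * u ^+ i).
  rewrite big_nat [leRHS]big_nat; apply: ler_sum => i /andP[Ki iM].
  rewrite addn2 /= -addn2 exprS mulrCA.
  rewrite ler_wpM2l// ler_wpM2r ?exprn_ge0// g_H1// NM addn2 !ltnS.
  exact: iM.
rewrite -mulr_sumr in h3.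
set S := \sum_(K <= i < M) g i * u ^+ i in h3 *.
set S' := \sum_(K <= i < M) _ in h3 *.
have e1 : u * (2 * K.+1%:R * g K.+1 * u ^+ K.-1) = 2 * (K.+1%:R * g K.+1 * u ^+ K).
  by rewrite -uK; ring.
rewrite e1 in h1u.
have e2 : u * (S + g M * u ^+ M + g M.+1 * u ^+ M.+1) = u * S + g M * u ^+ M.+1 + u * (g M.+1 * u ^+ M.+1).
  by rewrite uM; ring.
rewrite e2.
lra.
Qed.

Lemma gaussian_decay (u v : R) : 0 <= u -> u <= v ->
  expR (- (v ^+ 2 / 2)) * P v <= expR (- (u ^+ 2 / 2)) * P u.
Proof.
move=> u0 uv.
pose p : {poly R} := 1 + \sum_(K <= k < N.+1) g k *: 'X^k.
have pE x : p.[x] = P x.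
  rewrite /p hornerD hornerC horner_sum /P; congr (_ + _).
  by apply: eq_bigr => k _; rewrite hornerZ hornerXn.
have p'E x : (p^`()).[x] = \sum_(K <= k < N.+1) k%:R * g k * x ^+ k.-1.
  rewrite /p derivD derivC add0r raddf_sum horner_sum /=.
  apply: eq_bigr => k _; rewrite derivZ derivXn hornerZ hornerMn hornerXn.
  by rewrite -mulr_natl mulrCA mulrA.
pose f (x : R) : R := expR (- (x ^+ 2 / 2)) * p.[x].
have df x : is_derive x (1:R) f (expR (- (x ^+ 2 / 2)) * (p^`().[x] - x * p.[x])).
  have h1 := is_derive_gaussian x; have h2 := is_derive_poly p x.
  have h3 := is_deriveM h1 h2.
  apply: is_derive_eq.
  have sE (y z : R) : y *: (z : R^o) = y * z by [].
  by rewrite !sE; ring.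
rewrite -!pE -!/(f _).
have dbf x : derivable f x 1 by apply: ex_derive.
apply: (@ler0_derive1_le_cc _ f u v) => //.
- move=> x; rewrite in_itv /= => /andP[ux _].
  rewrite derive1E derive_val pmulr_rle0 ?expR_gt0// subr_le0 p'E pE.
  by rewrite derivative_bound// (le_trans u0)// ltW.
- by apply: derivable_within_continuous => x _.
- by rewrite in_itv /= lexx uv.
- by rewrite in_itv /= lexx uv.
Qed.

Hypothesis a_gt0 : 0 < a.
Hypothesis a_lt1 : a < 1.
Hypothesis a_rho : 1 <= a * Num.sqrt rho.

Let w : R := Num.sqrt (2 * (K + N)%:R * rho * - ln a).
Let d : R := \sum_(K <= k < N.+1) c k * w ^+ k.
Let b : R := Num.sqrt (1 - a ^+ 2).
Let t (j k : nat) : R := a ^+ j * (b * Num.sqrt (j + k)%:R) ^+ k * c k.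

Let tau_gt0 : 0 < - ln a.
Proof. by rewrite oppr_gt0 ln_lt0// a_gt0. Qed.

Let rho_ge1 : 1 <= rho.
Proof. by rewrite /rho lerDl divr_ge0. Qed.

Let rho_ge0 : 0 <= rho := le_trans ler01 rho_ge1.

Let d_ge0 : 0 <= d.
Proof. by apply: sumr_ge0 => k _; rewrite mulr_ge0 ?exprn_ge0 ?sqrtr_ge0. Qed.

Let b2_le : 1 - a ^+ 2 <= 2 * - ln a.
Proof.
have := expR_ge1Dx (ln (a ^+ 2)); rewrite lnK ?posrE ?exprn_gt0// lnXn//.
by rewrite -mulr_natl; lra.
Qed.

Let aX_le m n : (m <= n)%N -> a ^+ n <= a ^+ m.
Proof. by move=> mn; rewrite ler_wiXn2l// ltW. Qed.

Lemma tail_bound (n : nat) : (K + N <= n)%N ->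
  a ^+ n * P (Num.sqrt (2 * n%:R * - ln a)) <= a ^+ K * (1 + d).
Proof.
move=> KNn.
have expE (m : nat) : a ^+ m = expR (- (Num.sqrt (2 * m%:R * - ln a) ^+ 2 / 2)).
  rewrite sqr_sqrtr; last by rewrite !mulr_ge0// ltW.
  rewrite -{1}(@lnK _ a) ?posrE// -expRM_natl; congr expR; by field.
rewrite expE; apply: le_trans.
  apply: (@gaussian_decay (Num.sqrt (2 * (K + N)%:R * - ln a))).
    exact: sqrtr_ge0.
  by rewrite ler_wsqrtr// ler_wpM2r ?(ltW tau_gt0)// ler_wpM2l// ler_nat.
rewrite -expE.
(* The powers of [sqrt rho] in [g] complete the argument to [w]; this is where the coefficient of
   [log a] in [d_phi] comes from. *)
have -> : P (Num.sqrt (2 * (K + N)%:R * - ln a)) = 1 + d.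
  rewrite /P /d; congr (_ + _); apply: eq_bigr => k _.
  rewrite /g mulrAC -exprMn mulrC; congr (_ * _ ^+ _).
  by rewrite -sqrtrM// /w; congr Num.sqrt; ring.
by rewrite ler_wpM2r ?addr_ge0// aX_le// leq_addr.
Qed.

Let b_sqrt_le (x y : R) : 0 <= x -> x <= y ->
  b * Num.sqrt x <= Num.sqrt (2 * y * - ln a).
Proof.
move=> x0 xy; rewrite /b -sqrtrM; last by rewrite subr_ge0 expr_le1 ?ltW.
rewrite ler_wsqrtr// -mulrA (mulrC y) mulrA.
apply: ler_pM => //.
by rewrite subr_ge0 expr_le1 ?ltW.
Qed.

Let exprM_le (x y : R) k : 0 <= x -> x <= y -> x ^+ k <= y ^+ k.
Proof. by move=> x0 xy; rewrite lerXn2r ?nnegrE// (le_trans x0). Qed.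

Let b_ge0 : 0 <= b := sqrtr_ge0 _.
Let aX_ge0 n : 0 <= a ^+ n. Proof. by rewrite exprn_ge0// ltW. Qed.

(** Since [j >= K], one has [k <= N <= (N/K) j], so [j + k <= rho j]. Up to [j = K + N] this is at
    most [rho (K + N)] and the sum is compared with [d] directly; beyond, it is compared with [P] at
    [sqrt(2 j |log a|)], which decays. *)
Lemma column_sum_le (j : nat) : (K <= j)%N ->
  a ^+ j + \sum_(K <= k < N.+1) t j k <= a ^+ K * (1 + d).
Proof.
move=> Kj.
have jk k : (k <= N)%N -> (j + k)%:R <= rho * j%:R :> R.
  move=> kN; rewrite /rho mulrDl mul1r natrD lerD2l.
  rewrite mulrAC ler_pdivlMr ?ltr0n// -!natrM ler_nat.
  exact: leq_mul.
have -> : a ^+ j + \sum_(K <= k < N.+1) t j k = a ^+ j * (1 + \sum_(K <= k < N.+1)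
    (b * Num.sqrt (j + k)%:R) ^+ k * c k).
  by rewrite mulrDr mulr1 mulr_sumr; congr (_ + _); apply: eq_bigr => k _; rewrite mulrA.
have [jKN|KNj] := leqP j (K + N).
  apply: ler_pM => //; [|exact: aX_le|].
    by rewrite addr_ge0// sumr_ge0// => k _; rewrite mulr_ge0// exprn_ge0// mulr_ge0// sqrtr_ge0.
  rewrite lerD2l /d !big_nat; apply: ler_sum => k /andP[Kk kN].
  rewrite mulrC ler_wpM2l// exprM_le ?mulr_ge0 ?sqrtr_ge0//.
  rewrite /w -[X in _ <= Num.sqrt (X * _)]mulrA.
  apply: b_sqrt_le => //; apply: le_trans (jk _ kN) _.
  by rewrite [rho * _]mulrC ler_wpM2r// ler_nat.
apply: le_trans (tail_bound (ltnW KNj)).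
rewrite ler_wpM2l// /P lerD2l !big_nat; apply: ler_sum => k /andP[Kk kN].
rewrite /g mulrAC -exprMn ler_wpM2r// exprM_le ?mulr_ge0 ?sqrtr_ge0//.
rewrite -[X in _ <= X]sqrtrM// (_ : rho * _ = 2 * (rho * j%:R) * - ln a); last by ring.
by apply: b_sqrt_le => //; exact: jk.
Qed.

(** Here the binomials all have rank [n], but the power is [a^(n-k)]. Up to [n = K + N],
    [n - k >= K] suffices to bound it by [a^K]; beyond, the loss [a^(-k)] against [a^n] is paid by
    [sqrt(rho)^k]. *)
Lemma row_sum_le (n : nat) : (K <= n)%N ->
  a ^+ n + \sum_(K <= k < N.+1 | (K + k <= n)%N) t (n - k) k <= a ^+ K * (1 + d).
Proof.
move=> Kn.
have [nKN|KNn] := leqP n (K + N).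
  rewrite mulrDr mulr1 lerD ?aX_le// /d mulr_sumr big_mkcond /=.
  rewrite big_nat [leRHS]big_nat; apply: ler_sum => k /andP[Kk kN].
  have wk0 : 0 <= c k * w ^+ k by rewrite mulr_ge0 ?exprn_ge0 ?sqrtr_ge0.
  case: ifPn => [Kkn|_]; last by rewrite mulr_ge0.
  rewrite /t subnK; last by rewrite (leq_trans _ Kkn)// leq_addl.
  rewrite -mulrA; apply: ler_pM => //.
  - by rewrite mulr_ge0// exprn_ge0// mulr_ge0// sqrtr_ge0.
  - by rewrite aX_le// -(leq_add2r k) subnK// (leq_trans _ Kkn)// leq_addl.
  - rewrite mulrC ler_wpM2l// exprM_le ?mulr_ge0 ?sqrtr_ge0//.
    rewrite /w -[X in _ <= Num.sqrt (X * _)]mulrA; apply: b_sqrt_le => //.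
    rewrite -[leLHS]mulr1; apply: ler_pM => //.
    by rewrite ler_nat.
apply: le_trans (tail_bound (ltnW KNn)).
rewrite /P mulrDr mulr1 lerD2l mulr_sumr big_mkcond /=.
rewrite big_nat [leRHS]big_nat; apply: ler_sum => k /andP[Kk kN].
have wk0 (x : R) : 0 <= g k * Num.sqrt x ^+ k by rewrite mulr_ge0 ?exprn_ge0 ?sqrtr_ge0.
case: ifPn => [Kkn|_]; last by rewrite mulr_ge0.
have kn : (k <= n)%N by rewrite (leq_trans _ Kkn)// leq_addl.
rewrite /t subnK//.
have -> : a ^+ n = a ^+ (n - k) * a ^+ k by rewrite -exprD subnK.
rewrite -!mulrA ler_wpM2l// /g.
rewrite [leRHS](_ : _ = (a * Num.sqrt rho) ^+ k * (Num.sqrt (2 * (n%:R * - ln a)) ^+ k * c k)); last first.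
  by rewrite exprMn; ring.
rewrite -[leLHS]mul1r; apply: ler_pM => //.
- by rewrite mulr_ge0// exprn_ge0// mulr_ge0// sqrtr_ge0.
- by rewrite exprn_ege1.
- rewrite ler_wpM2r// exprM_le ?mulr_ge0 ?sqrtr_ge0//.
  by rewrite mulrA; exact: b_sqrt_le.
Qed.

Lemma ffact_le_expn n m : (n ^_ m <= n ^ m)%N.
Proof.
elim: m => [|m IH]; first by rewrite ffactn0.
by rewrite ffactnSr expnSr leq_mul// leq_subr.
Qed.

Variable Phi : nat -> R.
Hypothesis Phi0 : Phi 0%N = 1.
Hypothesis PhiE : forall k, (K <= k <= N)%N -> `|Phi k| = c k * Num.sqrt (k`!)%:R.
Hypothesis Phi_out : forall k, (0 < k)%N -> ~~ (K <= k <= N)%N -> Phi k = 0.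

Let v (j k : nat) : R := Num.sqrt ('C(j + k, j))%:R * a ^+ j * b ^+ k * `|Phi k|.

Let v_le j k : (K <= k <= N)%N -> v j k <= t j k.
Proof.
move=> kKN; rewrite /v /t PhiE// exprMn.
rewrite [leLHS](_ : _ = a ^+ j * (b ^+ k * (Num.sqrt ('C(j + k, j))%:R * Num.sqrt (k`!)%:R)) * c k); last by ring.
rewrite ler_wpM2r// ler_wpM2l// ler_wpM2l ?exprn_ge0//.
rewrite -sqrtrM// -natrM -[j in 'C(_, j)](addnK k) bin_sub ?leq_addl// bin_ffact.
have -> : Num.sqrt (j + k)%:R ^+ k = Num.sqrt ((j + k) ^ k)%:R :> R.
  rewrite natrX; elim: {kKN} k (j + k)%N => [|k IH] m; first by rewrite !expr0 sqrtr1.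
  by rewrite exprS IH exprS sqrtrM.
by rewrite ler_wsqrtr// ler_nat ffact_le_expn.
Qed.

Let v_ge0 j k : 0 <= v j k.
Proof.
apply: mulr_ge0 => //; apply: mulr_ge0; last exact: exprn_ge0.
by apply: mulr_ge0 => //; exact: sqrtr_ge0.
Qed.

Let t_ge0 j k : 0 <= t j k.
Proof.
apply: mulr_ge0 => //; apply: mulr_ge0 => //.
by apply: exprn_ge0; apply: mulr_ge0 => //; exact: sqrtr_ge0.
Qed.

Let v0 j : v j 0 = a ^+ j.
Proof. by rewrite /v addn0 binn sqrtr1 expr0 Phi0 normr1 !mulr1 mul1r. Qed.

(** The cut [M] is unrelated to the window [[K, N]] outside which, index 0 excepted, the
    coefficients of [phi] vanish; enlarging the range to [M + N + 1] makes it contain the window. *)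
Let sum_window_le (h f : nat -> R) M : (forall k, 0 <= f k) -> 0 <= h 0%N ->
  (forall k, (0 < k)%N -> h k <= if (K <= k <= N)%N then f k else 0) ->
  \sum_(0 <= k < M) h k <= h 0%N + \sum_(K <= k < N.+1) f k.
Proof.
move=> f0 h0 hf; have [->|M0] := posnP M.
  by rewrite big_geq// addr_ge0// sumr_ge0.
rewrite big_ltn// lerD2l.
pose f' k := if (K <= k <= N)%N then f k else 0.
have f'0 k : 0 <= f' k by rewrite /f'; case: ifP.
apply: (@le_trans _ _ (\sum_(1 <= k < M) f' k)).
  by rewrite big_nat [leRHS]big_nat; apply: ler_sum => k /andP[k0 _]; exact: hf.
apply: (@le_trans _ _ (\sum_(0 <= k < M + N.+1) f' k)).
  rewrite [leRHS]big_ltn ?addn_gt0 ?M0// ler_wpDl//.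
  rewrite (@big_cat_nat _ _ _ M 1%N (M + N.+1))//= ?leq_addr// lerDl.
  exact: sumr_ge0.
rewrite (@big_cat_nat _ _ _ K)//=; last first.
  by rewrite (leq_trans (leqW K_le_N))// leq_addl.
rewrite [X in X + _ <= _]big_nat big1 ?add0r; last first.
  by move=> k /andP[_ kK]; rewrite /f' leqNgt kK.
rewrite (@big_cat_nat _ _ _ N.+1)//= ?leq_addl ?leqW//.
rewrite [X in _ + X <= _](_ : _ = 0) ?addr0.
  rewrite big_nat [leRHS]big_nat; apply: ler_sum => k /andP[Kk kN].
  by rewrite /f' Kk -ltnS kN.
by rewrite big_nat big1// => k /andP[Nk _]; rewrite /f' [(k <= N)%N]leqNgt Nk andbF.
Qed.

Lemma mixed_column j M : (K <= j)%N -> \sum_(0 <= k < M) v j k <= a ^+ K * (1 + d).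
Proof.
move=> Kj; apply: le_trans (column_sum_le Kj); rewrite -v0.
apply: sum_window_le => // k k0; case: ifPn => [|out]; first exact: v_le.
by rewrite /v Phi_out// normr0 mulr0.
Qed.

Lemma mixed_row n : (K <= n)%N ->
  \sum_(0 <= k < n.+1 | (K + k <= n)%N) v (n - k) k <= a ^+ K * (1 + d).
Proof.
move=> Kn; apply: le_trans (row_sum_le Kn).
rewrite big_mkcond /= [X in _ <= _ + X]big_mkcond /=.
pose h k := if (K + k <= n)%N then v (n - k) k else 0.
have -> : a ^+ n = h 0%N by rewrite /h addn0 Kn subn0 v0.
apply: (@sum_window_le h) => [k||k k0].
- by case: ifP.
- by rewrite /h; case: ifP.
- rewrite /h; case: ifPn => [Kkn|_]; last by rewrite if_same.
  case: ifPn => [|out]; first exact: v_le.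
  by rewrite /v Phi_out// normr0 mulr0.
Qed.

End mixed_hermite_sum.

(** * The Schur test *)

Section schur_test.
Context {R : realType} (K : nat) (a b A : R) (F Phi : nat -> R).
Hypothesis K_gt0 : (0 < K)%N.
Hypothesis a_ge0 : 0 <= a.
Hypothesis b_ge0 : 0 <= b.
Hypothesis b_le1 : b <= 1.
Hypothesis F0 : F 0%N = 1.
Hypothesis FK : forall j, (0 < j < K)%N -> F j = 0.
Hypothesis Phi0 : Phi 0%N = 1.
Hypothesis PhiK : forall j, (0 < j < K)%N -> Phi j = 0.

Let w (j k : nat) : R := Num.sqrt ('C(j + k, j))%:R * a ^+ j * b ^+ k * `|Phi k|.

Hypothesis column : forall j M, (K <= j)%N -> \sum_(0 <= k < M) w j k <= A.
Hypothesis row : forall n, (K <= n)%N ->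
  \sum_(0 <= k < n.+1 | (K + k <= n)%N) w (n - k) k <= A.

Let w_ge0 j k : 0 <= w j k.
Proof. by rewrite !mulr_ge0 ?sqrtr_ge0 ?exprn_ge0. Qed.

Let A_ge0 : 0 <= A.
Proof. by apply: le_trans (column 0 (leqnn K)); rewrite big_geq. Qed.

(** [Q] stands for the Hermite coefficients of a test polynomial, the inner sum for the Hermite
    moments of the law of [aU + bV]. The subtracted sum is [Q 0], or 0 when [D = 0]; it cancels the
    entry [n = j = 0]. *)
Lemma schur_bound (D : nat) (Q : nat -> R) (SF SPhi : R) :
  0 <= SF -> 0 <= SPhi ->
  \sum_(1 <= j < D) F j ^+ 2 <= SF ^+ 2 ->
  \sum_(1 <= j < D) Phi j ^+ 2 <= SPhi ^+ 2 ->
  (\sum_(0 <= n < D) Q n * (\sum_(0 <= j < n.+1)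
     Num.sqrt ('C(n, j))%:R * a ^+ j * b ^+ (n - j) * F j * Phi (n - j)%N) - \sum_(0 <= n < D | n == 0%N) Q n) ^+ 2
  <= (A * SF + b ^+ K * SPhi) ^+ 2 * \sum_(0 <= n < D) Q n ^+ 2.
Proof.
move=> SF0 SPhi0 hF hPhi.
set q2 := \sum_(0 <= n < D) Q n ^+ 2.
have q20 : 0 <= q2 by apply: sumr_ge0 => n _; exact: sqr_ge0.
(* The entries with [j = 0 < n]. As [Phi n] vanishes below [K] and [b <= 1], the factor [b^n] is at
   most [b^K] wherever it matters. *)
pose T1 := \sum_(1 <= n < D) 1 * Q n * (b ^+ n * Phi n).
pose tau (n j : nat) : R := if (K <= j <= n)%N then w j (n - j) else 0.
have tau0 n j : 0 <= tau n j by rewrite /tau; case: ifP.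
pose T2 := \sum_(0 <= n < D) \sum_(0 <= j < D) tau n j * `|Q n| * `|F j|.
have T1le : T1 ^+ 2 <= (b ^+ K * SPhi) ^+ 2 * q2.
  apply: le_trans (weighted_cauchy_schwarz _ _ _ (fun=> ler01)) _.
  rewrite mulrC; apply: ler_pM.
  - by apply: sumr_ge0 => n _; rewrite mul1r sqr_ge0.
  - by apply: sumr_ge0 => n _; rewrite mul1r sqr_ge0.
  - rewrite exprMn; apply: (@le_trans _ _ ((b ^+ K) ^+ 2 * \sum_(1 <= j < D) Phi j ^+ 2)); last first.
      by rewrite ler_wpM2l ?sqr_ge0.
    rewrite mulr_sumr big_nat [leRHS]big_nat; apply: ler_sum => n /andP[n1 nD].
    rewrite mul1r exprMn; have [nK|Kn] := ltnP n K.
      by rewrite PhiK ?n1// expr0n !mulr0.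
    rewrite ler_wpM2r ?sqr_ge0// lerXn2r ?nnegrE ?exprn_ge0//.
    exact: ler_wiXn2l.
  - rewrite /q2; have [D0|D0] := posnP D; first by rewrite D0 !big_geq.
    rewrite [leRHS]big_ltn// -[leLHS]add0r lerD ?sqr_ge0//.
    by apply: ler_sum => n _; rewrite mul1r.
have rowtau n : \sum_(0 <= j < D) tau n j <= A.
  have [nK|Kn] := ltnP n K.
    rewrite big1 // => j _; rewrite /tau; case: ifPn => // /andP[Kj jn].
    by move: (leq_trans Kj jn); rewrite leqNgt nK.
  apply: le_trans (row Kn).
  apply: (@le_trans _ _ (\sum_(0 <= j < n.+1) tau n j)).
    have [Dn|nD] := leqP D n.+1.
      rewrite (@big_cat_nat _ _ _ D 0%N n.+1)//= lerDl; exact: sumr_ge0.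
    rewrite (@big_cat_nat _ _ _ n.+1 0%N D)//=; last exact: ltnW.
    rewrite [leLHS](_ : _ = \sum_(0 <= i < n.+1) tau n i)//.
    rewrite [X in _ + X](_ : _ = 0) ?addr0// big_nat big1// => j /andP[nj _].
    by rewrite /tau [(j <= n)%N]leqNgt nj andbF.
  (* Reversing the summation replaces [j] by [k = n - j], the index in which [row] is stated. *)
  rewrite big_nat_rev /= add0n [leRHS]big_mkcond /= big_nat [leRHS]big_nat.
  apply: ler_sum => k /andP[_ kn]; rewrite subSS /tau.
  rewrite leq_subr andbT leq_subRL 1?addnC// subKn//.
have coltau j : \sum_(0 <= n < D) tau n j <= A.
  have [jK|Kj] := ltnP j K.
    by rewrite big1 // => n _; rewrite /tau leqNgt jK.
  have [Dj|jD] := leqP D j.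
    rewrite big_nat big1 // => n /andP[_ nD]; rewrite /tau [(j <= n)%N]leqNgt.
    by rewrite (leq_trans nD Dj) andbF.
  rewrite (@big_cat_nat _ _ _ j 0%N D)//=; last exact: ltnW.
  rewrite big_nat big1 ?add0r; last first.
    by move=> n /andP[_ nj]; rewrite /tau [(j <= n)%N]leqNgt nj andbF.
  have -> : \sum_(j <= i < D) tau i j = \sum_(0 <= k < D - j) tau (k + j)%N j.
    by rewrite -{1}[j]add0n big_addn.
  apply: le_trans (column (D - j) Kj); rewrite big_nat [leRHS]big_nat.
  by apply: ler_sum => k _; rewrite /tau Kj leq_addl/= addnK.
(* Cauchy-Schwarz over the pairs [(n, j)] with weights [tau]: the row sums bound the factor in [Q],
   the column sums the factor in [F], by [A] each. *)
have T2le : T2 ^+ 2 <= (A * SF) ^+ 2 * q2.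
  rewrite /T2.
  have -> : \sum_(0 <= n < D) \sum_(0 <= j < D) tau n j * `|Q n| * `|F j| =
      \sum_(p <- [seq (n, j) | n <- index_iota 0 D, j <- index_iota 0 D])
        tau p.1 p.2 * `|Q p.1| * `|F p.2|.
    by rewrite big_allpairs.
  apply: le_trans (weighted_cauchy_schwarz _ _ _ (fun p => tau0 p.1 p.2)) _.
  rewrite !big_allpairs /= exchange_big /=.
  rewrite (_ : (A * SF) ^+ 2 * q2 = (A * q2) * (A * SF ^+ 2)); last by ring.
  apply: ler_pM.
  - by apply: sumr_ge0 => j _; apply: sumr_ge0 => n _; rewrite mulr_ge0 ?sqr_ge0.
  - by apply: sumr_ge0 => j _; apply: sumr_ge0 => n _; rewrite mulr_ge0 ?sqr_ge0.
  - rewrite exchange_big /= /q2 mulr_sumr; apply: ler_sum => n _.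
    by rewrite -mulr_suml real_normK ?num_real// ler_wpM2r ?sqr_ge0.
  - apply: (@le_trans _ _ (A * \sum_(1 <= j < D) F j ^+ 2)); last by rewrite ler_wpM2l.
    rewrite exchange_big /= mulr_sumr.
    have [D0|D0] := posnP D; first by rewrite D0 !big_geq.
    rewrite big_ltn// [X in X + _]big1 ?add0r; last first.
      by move=> n _; rewrite /tau leqNgt K_gt0 mul0r.
    by apply: ler_sum => j _; rewrite -mulr_suml real_normK ?num_real// ler_wpM2r ?sqr_ge0.
set T := (X in X ^+ 2 <= _).
have TE : `|T| <= `|T1| + T2.
  pose B n := Q n * \sum_(1 <= j < n.+1) Num.sqrt ('C(n, j))%:R * a ^+ j *
    b ^+ (n - j) * F j * Phi (n - j)%N.
  have -> : T = T1 + \sum_(0 <= n < D) B n.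
    have -> : T1 = \sum_(0 <= n < D) (if n == 0%N then 0 else Q n * (b ^+ n * Phi n)).
      have [D0|D0] := posnP D; first by rewrite /T1 D0 !big_geq.
      rewrite [RHS]big_ltn//= add0r /T1.
      by apply: eq_big_nat => -[|n] // _; rewrite mul1r.
    rewrite /T [X in _ - X]big_mkcond /= -sumrB -big_split /=; apply: eq_bigr => n _.
    rewrite big_ltn// /B mulrDr addrAC; congr (_ + _).
    rewrite bin0 sqrtr1 expr0 !mul1r subn0 F0 mulr1.
    by case: n => [|n] /=; [rewrite expr0 Phi0 !mulr1 subrr|rewrite subr0].
  apply: le_trans (ler_normD _ _) _; rewrite lerD2l.
  apply: le_trans (ler_norm_sum _ _ _) _; rewrite /T2 big_nat [leRHS]big_nat.
  apply: ler_sum => n /andP[_ nD]; rewrite /B normrM.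
  apply: (@le_trans _ _ (\sum_(1 <= j < n.+1) tau n j * `|Q n| * `|F j|)).
    apply: le_trans (ler_wpM2l (normr_ge0 _) (ler_norm_sum _ _ _)) _.
    rewrite mulr_sumr big_nat [leRHS]big_nat; apply: ler_sum => j /andP[j1 jn].
    have [jK|Kj] := ltnP j K.
      by rewrite FK ?j1// mulr0 mul0r normr0 !mulr0.
    have jn' : (j <= n)%N by rewrite -ltnS.
    rewrite /tau Kj jn' /= /w subnKC// !normrM.
    rewrite (ger0_norm (sqrtr_ge0 _)) (ger0_norm (exprn_ge0 j a_ge0)).
    rewrite (ger0_norm (exprn_ge0 _ b_ge0)).
    by rewrite le_eqVlt; apply/orP; left; apply/eqP; ring.
  have nn j : 0 <= tau n j * `|Q n| * `|F j| by rewrite !mulr_ge0.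
  rewrite [leRHS](@big_cat_nat _ _ _ n.+1 0%N D)//= [X in _ <= X + _]big_ltn//.
  rewrite -addrA ler_wpDl// lerDl.
  exact: sumr_ge0.
have T20 : 0 <= T2 by apply: sumr_ge0 => n _; apply: sumr_ge0 => j _; rewrite !mulr_ge0.
have sq_le (x y : R) : 0 <= y -> x ^+ 2 <= y ^+ 2 * q2 -> `|x| <= y * Num.sqrt q2.
  move=> y0 h; rewrite -(@ler_pXn2r _ 2) ?nnegrE ?mulr_ge0 ?sqrtr_ge0//.
  by rewrite real_normK ?num_real// exprMn sqr_sqrtr.
have h1 := sq_le _ _ (mulr_ge0 (exprn_ge0 K b_ge0) SPhi0) T1le.
have h2 := sq_le _ _ (mulr_ge0 A_ge0 SF0) T2le.
rewrite -[X in _ <= _ * X](sqr_sqrtr q20) -exprMn -[leLHS](real_normK (num_real _)).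
have S0 : 0 <= A * SF + b ^+ K * SPhi.
  by rewrite addr_ge0// mulr_ge0// exprn_ge0.
rewrite lerXn2r ?nnegrE ?(mulr_ge0 S0 (sqrtr_ge0 _))//.
rewrite (le_trans TE)// mulrDl addrC lerD//.
by rewrite -(ger0_norm T20).
Qed.

End schur_test.

(** * Hermite coefficients *)

Section hermite_coefficients.
Context {R : realType}.
Implicit Types (p q : {poly R}) (f g : R -> R).
Local Notation gaussR := (@gauss R).

Lemma Lfun2_measurable f : f \in Lfun gaussR 2%:E -> measurable_fun [set: R] f.
Proof. by rewrite inE => /andP[/[!inE]/= mf _]. Qed.

Lemma Lfun2_mul_integrable f g : f \in Lfun gaussR 2%:E -> g \in Lfun gaussR 2%:E ->
  gaussR.-integrable [set: R] (fun x => (f x * g x)%:E).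
Proof. by move=> f2 g2; apply/Lfun1_integrable; exact: Lfun2_mul_Lfun1. Qed.

Definition gexp p : R := \int[gauss]_x p.[x].

Lemma gexp_linear (c : R) p q : gexp (c *: p + q) = c * gexp p + gexp q.
Proof.
rewrite /gexp; under eq_Rintegral do rewrite hornerD hornerZ.
rewrite RintegralD//; last 2 first.
- have := integrable_horner (c *: p); apply: eq_integrable => // x _.
  by rewrite hornerZ.
- exact: integrable_horner.
by rewrite RintegralZl//; exact: integrable_horner.
Qed.

Lemma gexp0 : gexp 0 = 0.
Proof. by have := gexp_linear 1 0 0; rewrite scale1r addr0; lra. Qed.

Lemma gexpZ (c : R) p : gexp (c *: p) = c * gexp p.
Proof. by rewrite -[c *: p]addr0 gexp_linear gexp0 addr0. Qed.

Lemma gexpB p q : gexp (p - q) = gexp p - gexp q.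
Proof. by rewrite addrC -scaleN1r gexp_linear mulN1r addrC. Qed.

Lemma gexp_sum (I : Type) (s : seq I) (F : I -> {poly R}) :
  gexp (\sum_(i <- s) F i) = \sum_(i <- s) gexp (F i).
Proof.
elim: s => [|i s IH]; first by rewrite !big_nil gexp0.
by rewrite !big_cons -[F i]scale1r gexp_linear mul1r IH scale1r.
Qed.

Lemma gexp1 : gexp 1 = 1.
Proof.
rewrite /gexp /Rintegral; under eq_integral do rewrite hornerC.
rewrite integral_cst// mul1e -[X in _ = X]/(fine 1%:E); congr fine.
exact: probability_setT.
Qed.

Lemma gexp_ibp p : gexp ('X * p) = gexp (p^`()).
Proof.
apply/eqP; rewrite -subr_eq0 -gexpB; apply/eqP.
by rewrite /gexp /Rintegral integral_gauss_ibp.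
Qed.

(** By integration by parts, [X - D] is the adjoint of [D]: one factor loses a rank, the other is
    differentiated, and both indices decrease together. *)
Lemma gexp_He m n : gexp (He m * He n) = (m == n)%:R * n`!%:R.
Proof.
have shift k p : gexp (He k.+1 * p) = gexp (He k * p^`()).
  rewrite HeS mulrBl -mulrA gexpB gexp_ibp derivM -gexpB addrAC subrr add0r.
  by [].
elim: n m => [|n IH] [|m].
- by rewrite mulr1 gexp1 fact0 mulr1.
- by rewrite shift derivC mulr0 gexp0 mul0r.
- by rewrite mulrC shift derivC mulr0 gexp0 mul0r.
rewrite shift deriv_He -scalerAr gexpZ IH eqSS factS natrM; ring.
Qed.

Definition nHe n : {poly R} := (Num.sqrt (n`!)%:R)^-1 *: He n.

Lemma sqrt_fact_gt0 n : 0 < Num.sqrt (n`!)%:R :> R.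
Proof. by rewrite sqrtr_gt0 ltr0n fact_gt0. Qed.

Lemma horner_nHe n x : (nHe n).[x] = hermite n x.
Proof. by rewrite hermiteE hornerZ mulrC. Qed.

Lemma nHe0 : nHe 0 = 1.
Proof. by rewrite /nHe fact0 sqrtr1 invr1 scale1r. Qed.

Lemma gexp_nHe m n : gexp (nHe m * nHe n) = (m == n)%:R.
Proof.
rewrite -scalerAl -scalerAr !gexpZ gexp_He.
have [->|_] := eqVneq; last by rewrite mul0r !mulr0.
have s0 := sqrt_fact_gt0 n.
have -> : n`!%:R = Num.sqrt (n`!)%:R ^+ 2 :> R by rewrite sqr_sqrtr.
rewrite (_ : true%:R = 1 :> R)// mul1r sqrtr_sqr gtr0_norm//.
by field; rewrite gt_eqF.
Qed.

Lemma hcoef_horner p k : hcoef (horner p) k = gexp (p * nHe k).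
Proof. by apply: eq_Rintegral => x _; rewrite hornerM horner_nHe. Qed.

Lemma hermite_expansion p n : (size p <= n)%N ->
  p = \sum_(i < n) hcoef (horner p) i *: nHe i.
Proof.
move=> /He_span[c pE].
pose c' (i : nat) := c i * Num.sqrt (i`!)%:R.
have {}pE : p = \sum_(i < n) c' i *: nHe i.
  rewrite pE; apply: eq_bigr => i _.
  by rewrite scalerA -mulrA divff ?mulr1// gt_eqF// sqrt_fact_gt0.
rewrite {1}pE; apply: eq_bigr => i _; congr (_ *: _).
rewrite hcoef_horner pE mulr_suml gexp_sum (bigD1 i)//= big1 ?addr0.
  by rewrite -scalerAl gexpZ gexp_nHe eqxx mulr1.
move=> j ji; rewrite -scalerAl gexpZ gexp_nHe.
by rewrite (_ : (_ == _ :> nat) = false) ?mulr0//; apply/negbTE.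
Qed.

Lemma gexp_sqr_expansion p n : (size p <= n)%N ->
  gexp (p ^+ 2) = \sum_(i < n) hcoef (horner p) i ^+ 2.
Proof.
move=> sp; rewrite expr2 {1}(hermite_expansion sp) mulr_suml gexp_sum.
apply: eq_bigr => i _; rewrite -scalerAl gexpZ expr2; congr (_ * _).
by rewrite hcoef_horner mulrC.
Qed.

Lemma hcoef_horner_small p k : (size p <= k)%N -> hcoef (horner p) k = 0.
Proof.
move=> sp; rewrite hcoef_horner {1}(hermite_expansion (leqnn (size p))) mulr_suml gexp_sum big1//.
move=> i _; rewrite -scalerAl gexpZ gexp_nHe (_ : (_ == _ :> nat) = false) ?mulr0//.
by apply/negbTE; rewrite neq_ltn (leq_trans (ltn_ord i) sp).
Qed.

Lemma Rintegral_poly_sum f n (c : nat -> R) (P : nat -> {poly R}) :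
  f \in Lfun gaussR 2%:E ->
  \int[gauss]_x (f x * (\sum_(i < n) c i *: P i).[x]) =
  \sum_(i < n) c i * \int[gauss]_x (f x * (P i).[x]).
Proof.
move=> f2; have ifp p : gaussR.-integrable [set: R] (EFin \o (fun x => f x * p.[x])).
  by apply: Lfun2_mul_integrable => //; exact: horner_Lfun2.
elim: n => [|n IH].
  rewrite !big_ord0; under eq_Rintegral do rewrite horner0 mulr0.
  by rewrite Rintegral_cst// mul0r.
rewrite !big_ord_recr /= -IH.
transitivity (\int[gauss]_x (f x * (\sum_(i < n) c i *: P i).[x] + c n * (f x * (P n).[x]))).
  by apply: eq_Rintegral => x _; rewrite hornerD hornerZ; ring.
rewrite RintegralD//; last first.
  by have := ifp (c n *: P n); apply: eq_integrable => // x _; rewrite /= hornerZ mulrCA.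
by rewrite RintegralZl.
Qed.

Lemma bessel f n : f \in Lfun gaussR 2%:E ->
  \sum_(i < n) hcoef f i ^+ 2 <= \int[gauss]_x (f x ^+ 2).
Proof.
move=> f2; pose S : {poly R} := \sum_(i < n) hcoef f i *: nHe i.
have ff : gaussR.-integrable [set: R] (EFin \o (fun x => f x ^+ 2)).
  exact: Lfun2_mul_integrable.
have fS : gaussR.-integrable [set: R] (EFin \o (fun x => f x * S.[x])).
  by apply: Lfun2_mul_integrable => //; exact: horner_Lfun2.
have SS : gaussR.-integrable [set: R] (EFin \o (fun x => (S ^+ 2).[x])).
  exact: integrable_horner.
have fSE : \int[gauss]_x (f x * S.[x]) = \sum_(i < n) hcoef f i ^+ 2.
  rewrite Rintegral_poly_sum//; apply: eq_bigr => i _; rewrite expr2; congr (_ * _).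
  by apply: eq_Rintegral => x _; rewrite horner_nHe.
have SSE : \int[gauss]_x (S ^+ 2).[x] = \sum_(i < n) hcoef f i ^+ 2.
  rewrite -[LHS]/(gexp _) /S expr2 mulr_suml gexp_sum; apply: eq_bigr => i _.
  rewrite mulr_sumr gexp_sum (bigD1 i)//= big1 ?addr0.
    by rewrite -scalerAl -scalerAr !gexpZ gexp_nHe eqxx mulr1.
  move=> j ji; rewrite -scalerAl -scalerAr !gexpZ gexp_nHe.
  by rewrite (_ : (_ == _ :> nat) = false) ?mulr0//; apply/negbTE; rewrite eq_sym.
have : 0 <= \int[gauss]_x ((f x ^+ 2 - 2 * (f x * S.[x])) + (S ^+ 2).[x]).
  apply: Rintegral_ge0 => x _; rewrite horner_exp.
  by have := sqr_ge0 (f x - S.[x]); nra.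
rewrite RintegralD//; last first.
  by have := integrableB measurableT ff (integrableZl measurableT 2 fS).
rewrite RintegralB//; last exact: (integrableZl measurableT 2 fS).
rewrite RintegralZl// fSE SSE; lra.
Qed.

(** [nHe k] has degree [k <= r], so its integrals against [f] and against 1 coincide; the latter is
    given by orthonormality with [nHe 0 = 1]. *)
Lemma density_hcoef r f k : is_density f -> f \in Lfun gaussR 2%:E ->
  moments_match r f -> (k <= r)%N -> hcoef f k = (k == 0%N)%:R.
Proof.
move=> [mf f0 f1] f2 fr kr.
transitivity (gexp (nHe k * nHe 0)); last exact: gexp_nHe.
rewrite nHe0 mulr1.
have fX i : (i <= r)%N -> \int[gauss]_x (f x * ('X^i).[x]) = gexp 'X^i.
  case: i => [|i] ir.
    rewrite expr0 gexp1; under eq_Rintegral do rewrite hornerC mulr1.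
    by rewrite /Rintegral f1.
  rewrite /gexp /Rintegral; congr fine.
  have := fr i.+1; rewrite ir => /(_ isT) E.
  by under eq_integral do rewrite hornerXn mulrC; rewrite E; apply: eq_integral => x _; rewrite hornerXn.
have sk : (size (nHe k) <= k.+1)%N.
  by rewrite (leq_trans (size_scale_leq _ _))// (size_He k).1.
have nE : nHe k = \sum_(i < k.+1) (nHe k)`_i *: 'X^i.
  rewrite -poly_def; apply/polyP => i; rewrite coef_poly.
  by case: ltnP => // ki; rewrite nth_default// (leq_trans sk).
transitivity (\int[gauss]_x (f x * (nHe k).[x])).
  by apply: eq_Rintegral => x _; rewrite horner_nHe.
rewrite {1}nE (@Rintegral_poly_sum _ _ (fun i => (nHe k)`_i) (fun i => 'X^i))//.
rewrite nE gexp_sum; apply: eq_bigr => i _.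
by rewrite gexpZ -nE fX// (leq_trans _ kr)// -ltnS.
Qed.

(** A degree at most [r] would leave only the Hermite coefficient of index 0. This supplies
    [K <= N]. *)
Lemma deg_gt_r r p : is_density (horner p) -> moments_match r (horner p) ->
  p <> 1 -> (r < deg p)%N.
Proof.
move=> dp mp p1; rewrite ltnNge; apply/negP => pr; apply: p1.
have sp : (size p <= r.+1)%N by rewrite (leq_trans (leqSpred _)).
rewrite (hermite_expansion sp) big_ord_recl big1 => [|i _].
  by rewrite addr0 (density_hcoef dp (horner_Lfun2 _) mp)//= scale1r nHe0.
rewrite (density_hcoef dp (horner_Lfun2 _) mp) /=; last exact: ltn_ord.
by rewrite scale0r.
Qed.

(** It makes [gamma_N] positive, so that it can be the denominator [b] in the arithmetic-geometric
    bound. *)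
Lemma hcoef_deg_neq0 p : (0 < deg p)%N -> hcoef (horner p) (deg p) != 0.
Proof.
move=> p0; apply/negP => /eqP cp.
have sp : (size p <= (deg p).+1)%N by exact: leqSpred.
have : (size p <= deg p)%N.
  rewrite {1}(hermite_expansion sp) big_ord_recr /= cp scale0r addr0.
  apply: (leq_trans (size_sum _ _ _)); apply/bigmax_leqP => i _.
  rewrite (leq_trans (size_scale_leq _ _))// (leq_trans (size_scale_leq _ _))//.
  by rewrite (size_He i).1.
by rewrite leqNgt /deg prednK ?leqnn// (leq_trans p0)// leq_pred.
Qed.

(** It excludes [K = N = 1], where the base [N - 2] in (H2b) is negative. *)
Lemma density_deg_neq1 p : (forall x, 0 <= p.[x]) -> deg p <> 1%N.
Proof.
move=> p0 p1.
have sp : size p = 2 by move: p1; rewrite /deg; case: (size p) => [|[|[|]]].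
have c0 : p`_1 != 0.
  by have := lead_coef_eq0 p; rewrite lead_coefE sp /= -size_poly_eq0 sp => ->.
(* The point where [p] takes the value -1. *)
have := p0 (- (p`_0 + 1) / p`_1).
rewrite horner_coef sp !big_ord_recr big_ord0 /= add0r expr0 mulr1 expr1.
by rewrite mulrCA divff// mulr1; lra.
Qed.

End hermite_coefficients.

(** * Hypothesis (H) *)

Section hypothesis_H_consequences.
Context {R : realType}.
Implicit Types (phi : {poly R}).

Lemma powR_half (x : R) k : 0 <= x -> x `^ (k%:R / 2) = Num.sqrt x ^+ k.
Proof.
by move=> x0; rewrite mulrC powRrM powR12_sqrt// powR_mulrn// sqrtr_ge0.
Qed.

Lemma ratio_pow_bound (p q : nat) (b c u : R) :
  (p < q)%N -> 0 <= b -> 0 <= c -> 0 <= u ->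
  (((c / q%:R) ^+ q)%:E * ratio_pow (Posz p) b
    <= (1 / (q - p)%:R ^+ (q - p))%:E)%E ->
  c * u ^+ p <= 1 + b * u ^+ q.
Proof.
move=> pq b0 c0 u0; have q0 : (0 < q)%N by exact: leq_ltn_trans pq.
have [bp|] := boolP ((0 < b) || (p == 0%N)).
  move=> H; apply: monomial_le_1Dpow => //; move: H.
  rewrite /ratio_pow; move: bp => /orP[b_gt0|/eqP ->].
    by rewrite inver gt_eqF// -EFinM -EFin_expe -EFinM lee_fin.
  by rewrite expe0 mule1 expr0 mulr1 lee_fin.
(* In the remaining case [b = 0 < p], the second factor is [+oo] and a finite bound forces
   [c = 0]. *)
rewrite negb_or -leNgt => /andP[b_le0 p0].
have {b_le0} b0' : b = 0 by apply/eqP; rewrite eq_le b_le0 b0.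
rewrite b0' mul0r addr0.
have [->|c_neq0] := eqVneq c 0; first by move=> _; rewrite mul0r.
have cq : 0 < (c / q%:R) ^+ q.
  by rewrite exprn_gt0// divr_gt0 ?ltr0n// lt_neqAle eq_sym c_neq0.
rewrite /ratio_pow inver eqxx gt0_muley ?lte_fin ?ltr0n ?lt0n//.
have -> : (+oo ^+ p = +oo :> \bar R)%E.
  by case: p p0 {pq} => // p _; elim: p => // p IH; rewrite expeS IH mulyy.
by rewrite gt0_muley ?lte_fin// leye_eq.
Qed.

Lemma gamE K phi k : gam K phi k =
  Num.sqrt (1 + (deg phi)%:R / K%:R) ^+ k * (`|hcoef (horner phi) k| / Num.sqrt (k`!)%:R).
Proof.
rewrite /gam /Cst powR_half; first by ring.
by rewrite addr_ge0// divr_ge0.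
Qed.

Lemma gam_ge0 K phi k : 0 <= gam K phi k.
Proof. by rewrite gamE mulr_ge0 ?exprn_ge0 ?sqrtr_ge0// divr_ge0 ?sqrtr_ge0. Qed.

Lemma gam_deg_gt0 K phi : (0 < deg phi)%N -> 0 < gam K phi (deg phi).
Proof.
move=> d0; rewrite gamE mulr_gt0//.
by rewrite divr_gt0 ?normr_gt0 ?hcoef_deg_neq0// sqrt_fact_gt0.
Qed.

Lemma H2a_first r phi (u : R) : H2a r.+1 phi -> (r.+1 < deg phi)%N -> 0 <= u ->
  2 * (r.+1 + 1)%:R * gam r.+1 phi (r.+1 + 1) * u ^+ (r.+1 - 1)
    <= 1 + 2 * gam r.+1 phi (deg phi) * u ^+ deg phi.
Proof.
move=> H KN u0; have := H KN; rewrite ge_max => /andP[+ _].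
have -> : r.+1%:Z - 1 = Posz r by rewrite -addn1 PoszD addrK.
rewrite subn1 /= => h; apply: ratio_pow_bound => //.
- exact: ltnW.
- by apply: mulr_ge0; [|exact: gam_ge0].
- by apply: mulr_ge0; [rewrite mulr_ge0|exact: gam_ge0].
- by move: h; rewrite (_ : _ - r.+1 + 1 = deg phi - r)%N// addn1 subnSK// ltnW.
Qed.

Lemma H2a_second r phi (u : R) : H2a r.+1 phi -> (r.+1 < deg phi)%N -> 0 <= u ->
  2 * r.+1%:R * gam r.+1 phi r.+1 * u ^+ (r.+1 - 1)
    <= u + 2 * gam r.+1 phi (deg phi - 1) * u ^+ deg phi.
Proof.
move=> H KN u0; have := H KN; rewrite ge_max => /andP[_].
have [N NE] : exists N, deg phi = N.+2 by case: (deg phi) KN => [|[|N]] // _; exists N.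
have r0 k : 0 <= 2 * gam r.+1 phi k * u ^+ k.+1 
  by apply: mulr_ge0; [apply: mulr_ge0; [|exact: gam_ge0]|exact: exprn_ge0].
rewrite NE !subn1 /=; case: r H KN r0 => [|r] H KN r0.
  (* For [K = 1] the exponent [K - 2] is -1, where [ratio_pow] is [+oo]; the bound then forces
     [gamma_1 = 0]. *)
  rewrite /= => h; suff -> : gam 1 phi 1 = 0 by rewrite mulr0 mul0r addr_ge0.
  apply/eqP/negP => /negP g1.
  have gt0 : 0 < (2 * 1 * gam 1 phi 1 / N.+1%:R) ^+ N.+1.
    by rewrite exprn_gt0// divr_gt0// mulr_gt0// lt_neqAle eq_sym g1 gam_ge0.
  by move: h; rewrite gt0_muley ?lte_fin// leye_eq.
have -> : r.+2%:Z - 2%:Z = Posz r by rewrite -addn2 PoszD addrK.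
(* The condition speaks of the powers [K - 2] and [N - 1]; multiplying by [u] gives the inequality
   claimed. *)
move=> h; have : 2 * r.+2%:R * gam r.+2 phi r.+2 * u ^+ r <= 1 + 2 * gam r.+2 phi N.+1 * u ^+ N.+1.
  apply: ratio_pow_bound => //.
  - by rewrite NE in KN; rewrite -ltnS; apply: ltnW.
  - by apply: mulr_ge0; [|exact: gam_ge0].
  - by apply: mulr_ge0; [rewrite mulr_ge0|exact: gam_ge0].
  - move: h; rewrite NE in KN.
    suff -> : (N.+2 - r.+2 + 1 = N.+1 - r)%N by [].
    by rewrite !subSS addn1 subSn// -ltnS -ltnS ltnW// -ltnS.
move: (gam _ _ _) (gam _ _ _) => g1 g2 /(ler_wpM2l u0) h2.
rewrite [leLHS](_ : _ = u * (2 * r.+2%:R * g2 * u ^+ r)); last by rewrite exprS; ring.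
by apply: (le_trans h2); rewrite mulrDr mulr1 lerD2l (exprS u N.+1) mulrCA.
Qed.

(** Take [q = N], [p = N - 2], [b = gamma_N] and [c = N gamma_N] in the arithmetic-geometric bound:
    its condition becomes [gamma_N^2 (N-2)^(N-2) <= 1/4], the square of (H2b). Multiplying by [u]
    gives the powers in the statement. *)
Lemma H2b_bound r phi (u : R) : (forall x, 0 <= phi.[x]) -> H2b r.+1 phi ->
  r.+1 = deg phi -> 0 <= u ->
  (deg phi)%:R * gam r.+1 phi (deg phi) * u ^+ (deg phi - 1) <=
  u + gam r.+1 phi (deg phi) * u ^+ (deg phi + 1).
Proof.
move=> phi0 H KN u0; have := H KN; have := density_deg_neq1 phi0.
have := @gam_deg_gt0 r.+1 phi; rewrite -KN => /(_ isT).
case: r {H KN} => [|m] // g0 _ hg.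
have {hg} : gam m.+2 phi m.+2 <= 1 / (2 * Num.sqrt m%:R ^+ m).
  by move: hg; rewrite -addn2 natrD addrK powR_half.
move: g0; set g := gam _ _ _ => g0 hg.
have : (m + 2)%:R * g * u ^+ m <= 1 + g * u ^+ (m + 2).
  apply: monomial_le_1Dpow => //.
  - by rewrite addn2.
  - exact: ltW.
  - by rewrite mulr_ge0// ltW.
  - by rewrite g0.
  rewrite addKn mulrAC mulfV ?mul1r; last by rewrite pnatr_eq0 addn2.
  have -> : g ^+ (m + 2) * (m%:R / g) ^+ m = g ^+ 2 * m%:R ^+ m.
    by rewrite addnC exprD -mulrA -exprMn mulrC (mulrC g) divfK ?gt_eqF// mulrC.
  (* For [N = 2] the power is [0^0 = 1] and (H2b) reads [gamma_2 <= 1/2]. *)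
  have [m0|m0] := posnP m.
    rewrite m0 !expr0 !mulr1 in hg *.
    have : g ^+ 2 <= (1 / 2) ^+ 2 by rewrite lerXn2r ?nnegrE ?(ltW g0).
    by rewrite expr_div_n expr1n div1r.
  have s0 : 0 < Num.sqrt m%:R ^+ m :> R by rewrite exprn_gt0// sqrtr_gt0 ltr0n.
  have : (g * Num.sqrt m%:R ^+ m) ^+ 2 <= (1 / 2) ^+ 2.
    rewrite lerXn2r ?nnegrE ?(mulr_ge0 (ltW g0) (ltW s0))//.
    by rewrite -ler_pdivlMr// (le_trans hg)// !div1r invfM.
  rewrite exprMn -exprM mulnC exprM sqr_sqrtr// => /le_trans; apply.
  by rewrite expr_div_n expr1n div1r.
move=> /(ler_wpM2l u0); rewrite mulrDr mulr1 => h2.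
rewrite subn1 addn1 /= exprS mulrCA.
by move: h2; rewrite addn2 (exprS u m.+2) [u * (g * _)]mulrCA.
Qed.

End hypothesis_H_consequences.

Section mixing_constants.
Context {R : realType} (r : nat) (phi : {poly R}) (a : R).
Hypothesis phi_density : is_density (horner phi).
Hypothesis phi_moments : moments_match r (horner phi).
Hypothesis HH : hypH r phi.
Hypothesis ha : a_phi r phi < a < 1.

Let b : R := Num.sqrt (1 - a ^+ 2).
Let Phi k := hcoef (horner phi) k.
Let w (j k : nat) : R := Num.sqrt ('C(j + k, j))%:R * a ^+ j * b ^+ k * `|Phi k|.

Lemma a_gt0 : 0 < a.
Proof.
move: ha => /andP[+ _]; apply: le_lt_trans.
by rewrite /a_phi; case: ifP => // _; exact: powR_ge0.
Qed.

Let a_lt1 : a < 1. Proof. by have /andP[] := ha. Qed.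

Let Phi0 : Phi 0 = 1.
Proof. exact: (density_hcoef phi_density (horner_Lfun2 _) phi_moments). Qed.

Lemma mixing_constant_bounds :
  (forall j M, (r.+1 <= j)%N ->
    \sum_(0 <= k < M) w j k <= a ^+ r.+1 * (1 + d_phi r phi a)) /\
  (forall n, (r.+1 <= n)%N ->
    \sum_(0 <= k < n.+1 | (r.+1 + k <= n)%N) w (n - k) k
      <= a ^+ r.+1 * (1 + d_phi r phi a)).
Proof.
have a0 := ltW a_gt0; have a1 := ltW a_lt1.
(* For [phi = 1] the matrix is diagonal with entries [a^j], and [d_phi] is 0. *)
have [phi1|/eqP phi1] := eqVneq phi 1.
  have wk j k : (0 < k)%N -> w j k = 0.
    move=> k0; rewrite /w /Phi phi1 hcoef_horner_small ?normr0 ?mulr0//.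
    by rewrite size_poly1.
  have w0 j : w j 0 = a ^+ j.
    by rewrite /w Phi0 addn0 binn sqrtr1 expr0 normr1 !mulr1 mul1r.
  have -> : d_phi r phi a = 0.
    by rewrite /d_phi phi1 /deg size_poly1 big_geq.
  rewrite addr0 mulr1; split => [j M Kj|n Kn].
    have [->|M0] := posnP M; first by rewrite big_geq// exprn_ge0.
    rewrite big_ltn// big_nat big1 => [|k /andP[k0 _]]; last exact: wk.
    by rewrite addr0 w0 ler_wiXn2l.
  rewrite big_ltn_cond// addn0 Kn subn0 big_nat_cond big1 => [|k /andP[/andP[k0 _] _]]; last exact: wk.
  by rewrite addr0 w0 ler_wiXn2l.
have [H1' H2a' H2b'] := HH phi1.
have rN : (r.+1 <= deg phi)%N := deg_gt_r phi_density phi_moments phi1.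
have [_ phi_ge0 _] := phi_density.
pose c k : R := `|Phi k| / Num.sqrt (k`!)%:R.
pose rho : R := 1 + (deg phi)%:R / r.+1%:R.
have rho1 : 1 <= rho by rewrite lerDl divr_ge0.
have gE k : Num.sqrt rho ^+ k * c k = gam r.+1 phi k by rewrite gamE.
have c0 k : 0 <= c k by rewrite divr_ge0 ?sqrtr_ge0.
(* [rho^(-1/4) sqrt(rho) = rho^(1/4)], which is at least 1 because [rho >= 1]. *)
have arho : 1 <= a * Num.sqrt rho.
  move: ha => /andP[+ _]; rewrite /a_phi; have /eqP/negbTE -> := phi1 => /ltW ha'.
  have rho_gt0 : 0 < rho by exact: lt_le_trans rho1.
  apply: le_trans (ler_wpM2r (sqrtr_ge0 _) ha').
  rewrite -powR12_sqrt ?(ltW rho_gt0)// -powRD; last by apply/implyP => _; rewrite gt_eqF.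
  by rewrite -{1}(powRr0 rho) ler_powR//; lra.
have dE : d_phi r phi a = \sum_(r.+1 <= k < (deg phi).+1) c k *
    Num.sqrt (2 * (r.+1 + deg phi)%:R * rho * - ln a) ^+ k.
  apply: eq_bigr => k _; rewrite (_ : - 2 * _ * _ * _ = 2 * (r.+1 + deg phi)%:R * rho * - ln a).
    rewrite powR_half// !mulr_ge0 ?oppr_ge0 ?ln_le0//.
    exact: le_trans rho1.
  by rewrite /rho; ring.
have PhiE k : (r.+1 <= k <= deg phi)%N -> `|Phi k| = c k * Num.sqrt (k`!)%:R.
  by move=> _; rewrite /c divfK// gt_eqF// sqrt_fact_gt0.
have Phi_out k : (0 < k)%N -> ~~ (r.+1 <= k <= deg phi)%N -> Phi k = 0.
  move=> k0; rewrite negb_and -!ltnNge => /orP[kr|Nk].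
    rewrite /Phi (density_hcoef phi_density (horner_Lfun2 _) phi_moments)//.
    by rewrite gtn_eqF.
  by apply: hcoef_horner_small; rewrite (leq_trans (leqSpred _)).
have P1 k : (r.+1 <= k)%N -> (k + 2 <= deg phi)%N ->
    (k + 2)%:R * (Num.sqrt rho ^+ (k + 2) * c (k + 2)%N) <= Num.sqrt rho ^+ k * c k.
  by move=> Kk kN; rewrite !gE; exact: H1'.
have P2 : (r.+1 < deg phi)%N -> forall u : R, 0 <= u ->
  2 * (r.+1 + 1)%:R * (Num.sqrt rho ^+ (r.+1 + 1) * c (r.+1 + 1)%N) * u ^+ (r.+1 - 1) <=
  1 + 2 * (Num.sqrt rho ^+ (deg phi) * c (deg phi)) * u ^+ deg phi.
  by move=> KN u u0; rewrite !gE; exact: H2a_first.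
have P3 : (r.+1 < deg phi)%N -> forall u : R, 0 <= u ->
  2 * r.+1%:R * (Num.sqrt rho ^+ r.+1 * c r.+1) * u ^+ (r.+1 - 1) <=
  u + 2 * (Num.sqrt rho ^+ (deg phi - 1) * c (deg phi - 1)%N) * u ^+ deg phi.
  by move=> KN u u0; rewrite !gE; exact: H2a_second.
have P4 : r.+1 = deg phi -> forall u : R, 0 <= u ->
  (deg phi)%:R * (Num.sqrt rho ^+ deg phi * c (deg phi)) * u ^+ (deg phi - 1) <=
  u + (Num.sqrt rho ^+ deg phi * c (deg phi)) * u ^+ (deg phi + 1).
  by move=> KN u u0; rewrite !gE; exact: H2b_bound.
rewrite dE; split => [j M Kj|n Kn].
  exact: (mixed_column (ltn0Sn r) rN c0 P1 P2 P3 P4 a_gt0 a_lt1 Phi0 PhiE Phi_out M Kj).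
exact: (mixed_row (ltn0Sn r) rN c0 P1 P2 P3 P4 a_gt0 a_lt1 arho Phi0 PhiE Phi_out Kn).
Qed.

End mixing_constants.

(** * The law of a linear combination *)

Section image_measure.
Local Open Scope ereal_scope.
Context d1 d2 (X : measurableType d1) (Y : measurableType d2) (R : realType).
Variables (m : {measure set X -> \bar R}) (n : {measure set Y -> \bar R}).
Variables (h : X -> Y) (mh : measurable_fun [set: X] h).
Hypothesis nE : forall A, measurable A -> n A = m (h @^-1` A).

Lemma ge0_integral_image (g : Y -> \bar R) : measurable_fun [set: Y] g ->
  (forall y, 0 <= g y) -> \int[n]_y g y = \int[m]_x g (h x).
Proof.
move=> mg g0; transitivity (\int[m]_(x in h @^-1` [set: Y]) (g \o h) x).
  rewrite -(ge0_integral_pushforward mh m measurableT)//.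
  by apply: eq_measure_integral => A mA _; exact: nE.
by rewrite preimage_setT.
Qed.

Lemma integrable_image (g : Y -> \bar R) : measurable_fun [set: Y] g ->
  n.-integrable [set: Y] g -> m.-integrable [set: X] (g \o h).
Proof.
move=> mg /integrableP[_ ig]; apply/integrableP; split.
  exact: measurableT_comp.
rewrite -(@ge0_integral_image (fun y => `|g y|))//.
exact: measurableT_comp.
Qed.

Lemma integral_image (g : Y -> \bar R) : measurable_fun [set: Y] g ->
  n.-integrable [set: Y] g -> \int[n]_y g y = \int[m]_x g (h x).
Proof.
move=> mg ig; transitivity (\int[m]_(x in h @^-1` [set: Y]) (g \o h) x).
  rewrite -(integral_pushforward mh mg _ measurableT).
    by apply: eq_measure_integral => A mA _; exact: nE.
  by rewrite preimage_setT; exact: integrable_image.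
by rewrite preimage_setT.
Qed.

End image_measure.

Section polynomial_integrals.
Context {R : realType} (m : {measure set (measurableTypeR R) -> \bar R}).
Hypothesis im : forall p : {poly R}, m.-integrable [set: R] (fun x => (p.[x])%:E).

Lemma Rintegral_horner_sum n (c : nat -> R) (P : nat -> {poly R}) :
  \int[m]_x (\sum_(i < n) c i *: P i).[x] = \sum_(i < n) c i * \int[m]_x (P i).[x].
Proof.
elim: n => [|n IH].
  rewrite !big_ord0; under eq_Rintegral do rewrite horner0.
  by rewrite Rintegral_cst// mul0r.
rewrite !big_ord_recr /= -IH.
transitivity (\int[m]_x ((\sum_(i < n) c i *: P i).[x] + c n * (P n).[x])).
  by apply: eq_Rintegral => x _; rewrite hornerD hornerZ.
rewrite RintegralD//; last 2 first.
- exact: im.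
- by have := im (c n *: P n); apply: eq_integrable => // x _; rewrite /= hornerZ.
by rewrite RintegralZl//; exact: im.
Qed.

End polynomial_integrals.

(** * Integrals and Hermite moments under the law of [aU + bV] *)

Section convolution.
Context {R : realType}.
Local Notation gaussR := (@gauss R).
Local Notation mR := (measurableTypeR R).
Variables (m1 m2 nu : probability mR R) (f phi : R -> R) (a b : R).
Hypothesis f_density : is_density f.
Hypothesis phi_density : is_density phi.
Hypothesis f_L2 : f \in Lfun gaussR 2%:E.
Hypothesis phi_L2 : phi \in Lfun gaussR 2%:E.
Hypothesis m1E : forall A, measurable A -> m1 A = (\int[gauss]_(x in A) (f x)%:E)%E.
Hypothesis m2E : forall A, measurable A -> m2 A = (\int[gauss]_(x in A) (phi x)%:E)%E.
Hypothesis ab1 : a ^+ 2 + b ^+ 2 = 1.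
Hypothesis b_gt0 : 0 < b.
Let S (xy : mR * mR) : mR := a * xy.1 + b * xy.2.
Hypothesis nuE : forall A, measurable A -> nu A = (m1 \x m2)%E (S @^-1` A).

Let mf : measurable_fun [set: R] f := Lfun2_measurable f_L2.
Let mphi : measurable_fun [set: R] phi := Lfun2_measurable phi_L2.
Let f0 x : 0 <= f x. Proof. by have [] := f_density. Qed.
Let phi0 x : 0 <= phi x. Proof. by have [] := phi_density. Qed.

Let mS : measurable_fun [set: mR * mR] S.
Proof. by apply: measurable_funD; apply: measurable_funM. Qed.

(** The squared L^2 norm of the joint density with respect to the product Gaussian measure. *)
Let C : R := (\int[gauss]_x (f x ^+ 2)) * \int[gauss]_x (phi x ^+ 2).

Lemma ge0_integral_product_density (G : mR * mR -> \bar R) :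
  measurable_fun [set: mR * mR] G -> (forall xy, 0 <= G xy)%E ->
  (\int[m1 \x m2]_xy G xy =
   \int[gaussR \x gaussR]_xy (G xy * (f xy.1 * phi xy.2)%:E))%E.
Proof.
move=> mG G0.
have mphi2 : measurable_fun [set: mR * mR] (fun xy => (phi xy.2)%:E).
  by apply/measurable_EFinP; apply: measurableT_comp => //; exact: measurable_snd.
have mf1 : measurable_fun [set: mR * mR] (fun xy => (f xy.1)%:E).
  by apply/measurable_EFinP; apply: measurableT_comp => //; exact: measurable_fst.
have mGphi : measurable_fun [set: mR * mR] (fun xy => G xy * (phi xy.2)%:E)%E.
  exact: emeasurable_funM.
have Gphi0 xy : (0 <= G xy * (phi xy.2)%:E)%E by rewrite mule_ge0// lee_fin.
have mGx x : measurable_fun [set: mR] (fun y => G (x, y)).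
  by apply: measurableT_comp mG _; exact: pair1_measurable.
transitivity (\int[m1]_x \int[m2]_y G (x, y))%E.
  exact: fubini_tonelli1.
transitivity (\int[gauss]_x ((\int[gauss]_y (G (x, y) * (phi y)%:E)) * (f x)%:E))%E.
  transitivity (\int[m1]_x (\int[gauss]_y (G (x, y) * (phi y)%:E)))%E.
    apply: eq_integral => x _.
    by apply: (ge0_integral_density (mu := gaussR) (m := m2)).
  apply: (ge0_integral_density (mu := gaussR) (m := m1)) => //.
    exact: (@measurable_fun_fubini_tonelli_F _ _ _ _ _ gaussR _ mGphi Gphi0).
  by move=> x; apply: integral_ge0 => y _; exact: (Gphi0 (x, y)).
transitivity (\int[gauss]_x \int[gauss]_y (G (x, y) * (f x * phi y)%:E))%E.
  apply: eq_integral => x _; rewrite -ge0_integralZr ?lee_fin//.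
  - by apply: eq_integral => y _; rewrite EFinM muleA muleAC.
  - by apply: emeasurable_funM => //; exact/measurable_EFinP.
apply/esym.
apply: (@fubini_tonelli1 _ _ _ _ _ gaussR gaussR (fun xy => (G xy * (f xy.1 * phi xy.2)%:E)%E)).
- by under eq_fun do rewrite EFinM muleA; apply: emeasurable_funM => //; exact: emeasurable_funM.
- by move=> xy; rewrite mule_ge0// lee_fin mulr_ge0.
Qed.

Let intf2 : (\int[gauss]_x (f x ^+ 2)%:E = (\int[gauss]_x (f x ^+ 2))%:E)%E.
Proof.
rewrite /Rintegral fineK//; apply: integrable_fin_num => //.
exact: (Lfun2_mul_integrable f_L2 f_L2).
Qed.

Let intphi2 : (\int[gauss]_x (phi x ^+ 2)%:E = (\int[gauss]_x (phi x ^+ 2))%:E)%E.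
Proof.
rewrite /Rintegral fineK//; apply: integrable_fin_num => //.
exact: (Lfun2_mul_integrable phi_L2 phi_L2).
Qed.

(* [nu] need not have a density in L^2, but [m1 \x m2] has one; its norm enters
   only through the constant [C], which disappears when [s] tends to +oo. *)
Lemma image_L1_bound (q : R -> R) (s : R) : measurable_fun [set: R] q ->
  (forall x, 0 <= q x) -> 0 < s ->
  (2%:E * \int[nu]_x (q x)%:E <= s%:E * sqnorm q + (C / s)%:E)%E.
Proof.
move=> mq q0 s0.
have mEq : measurable_fun [set: R] (fun x => (q x)%:E) by exact/measurable_EFinP.
have mqS : measurable_fun [set: mR * mR] (fun xy => (q (S xy))%:E).
  exact: measurableT_comp mEq mS.
have mffi : measurable_fun [set: mR * mR] (fun xy => (f xy.1 * phi xy.2)%:E).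
  apply/measurable_EFinP; by apply: measurable_funM; apply: measurableT_comp.
have mq2 : measurable_fun [set: R] (fun x => (q x ^+ 2)%:E).
  by apply/measurable_EFinP; exact: measurable_funX.
have mq2S : measurable_fun [set: mR * mR] (fun xy => (q (S xy) ^+ 2)%:E).
  exact: measurableT_comp mq2 mS.
have mffi2 : measurable_fun [set: mR * mR] (fun xy => ((f xy.1 * phi xy.2) ^+ 2)%:E).
  by apply/measurable_EFinP; apply: measurable_funX; exact/measurable_EFinP.
have -> : (\int[nu]_x (q x)%:E = \int[gaussR \x gaussR]_xy ((q (S xy))%:E * (f xy.1 * phi xy.2)%:E))%E.
  rewrite (ge0_integral_image mS nuE mEq); last by move=> y; rewrite lee_fin.
  by apply: ge0_integral_product_density => // xy; rewrite lee_fin.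
(* Rotation invariance: [S] sends the product Gaussian measure to the Gaussian measure. *)
have -> : (sqnorm q = \int[gaussR \x gaussR]_xy (q (S xy) ^+ 2)%:E)%E.
  rewrite /sqnorm -(ge0_integral_gauss_rotation ab1 b_gt0 mq2); last first.
    by move=> x; rewrite lee_fin sqr_ge0.
  apply/esym; apply: (@fubini_tonelli1 _ _ _ _ _ gaussR gaussR (fun xy => (q (S xy) ^+ 2)%:E)) => // xy.
  by rewrite lee_fin sqr_ge0.
have -> : ((C / s)%:E = s^-1%:E * \int[gaussR \x gaussR]_xy ((f xy.1 * phi xy.2) ^+ 2)%:E)%E.
  rewrite mulrC EFinM; congr (_ * _)%E.
  rewrite (@fubini_tonelli1 _ _ _ _ _ gaussR gaussR (fun xy => ((f xy.1 * phi xy.2) ^+ 2)%:E)) //=; last by move=> xy; rewrite lee_fin sqr_ge0.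
  transitivity (\int[gauss]_x ((f x ^+ 2)%:E * \int[gauss]_y (phi y ^+ 2)%:E))%E.
    rewrite intphi2 ge0_integralZr//.
    - by rewrite intf2 -EFinM.
    - by apply/measurable_EFinP; exact: measurable_funX.
    - by move=> x _; rewrite lee_fin sqr_ge0.
    - by rewrite lee_fin; apply: Rintegral_ge0 => x _; exact: sqr_ge0.
  apply: eq_integral => x _; rewrite /fubini_F /= -ge0_integralZl ?lee_fin ?sqr_ge0//.
  - by apply: eq_integral => y _; rewrite exprMn EFinM.
  - by apply/measurable_EFinP; exact: measurable_funX.
  - by move=> y _; rewrite lee_fin sqr_ge0.
have s_ge0 := ltW s0; have sV0 : 0 <= s^-1 by rewrite invr_ge0.
rewrite -!ge0_integralZl//.
- rewrite -ge0_integralD//.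
  + apply: ge0_le_integral => //.
    * by move=> xy _; rewrite -!EFinM lee_fin !mulr_ge0.
    * by apply: measurable_funeM; exact: emeasurable_funM.
    * by apply: emeasurable_funD; apply: measurable_funeM.
    * move=> xy _; rewrite -!EFinM -EFinD lee_fin.
      set u := q _; set v := f _ * phi _.
      (* Pointwise, [2 u v <= s u^2 + v^2 / s]. *)
      rewrite -subr_ge0 (_ : _ - _ = s^-1 * (s * u - v) ^+ 2).
        by rewrite mulr_ge0 ?sqr_ge0.
      by field; rewrite gt_eqF.
  + by move=> xy _; rewrite -EFinM lee_fin mulr_ge0// sqr_ge0.
  + exact: measurable_funeM.
  + by move=> xy _; rewrite -EFinM lee_fin mulr_ge0// sqr_ge0.
  + exact: measurable_funeM.
- by move=> xy _; rewrite lee_fin sqr_ge0.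
- by move=> xy _; rewrite lee_fin sqr_ge0.
- exact: emeasurable_funM.
- by move=> xy _; rewrite -EFinM lee_fin !mulr_ge0.
Qed.

Lemma image_dominated : nu `<< gaussR.
Proof.
apply/null_content_dominatesP => A mA gA0.
have mI : measurable_fun [set: R] (\1_A : R -> R) by exact: measurable_indic.
have sq0 : (sqnorm (\1_A : R -> R) = 0)%E.
  transitivity (\int[gauss]_x (\1_A x)%:E)%E.
    by apply: eq_integral => x _; rewrite indicE; case: (_ \in _); rewrite ?expr1n ?expr0n.
  by rewrite integral_indic// setIT.
have C0 : 0 <= C.
  by apply: mulr_ge0; apply: Rintegral_ge0 => x _; exact: sqr_ge0.
have nu_fin : nu A \is a fin_num by exact: fin_num_measure.
have EA : (\int[nu]_x (\1_A x)%:E = nu A)%E by rewrite integral_indic// setIT.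
have [//|nuA] := eqVneq (nu A) 0%E; exfalso.
have nuA_gt0 : 0 < fine (nu A).
  by rewrite fine_gt0// lt0e nuA measure_ge0/= -ge0_fin_numE ?measure_ge0.
(* On a Gaussian-null set the bound reads [2 nu(A) <= C / s]; this [s] makes [C / s] smaller than
   [nu(A)]. *)
have s0 : 0 < (C + 1) / fine (nu A) by rewrite divr_gt0// ltr_wpDl.
have I0 x : 0 <= (\1_A x : R) by rewrite indicE.
have := image_L1_bound mI I0 s0; rewrite sq0 mule0 add0e.
rewrite EA -(fineK nu_fin) -EFinM lee_fin.
rewrite invf_div mulrA ler_pdivlMr ?ltr_wpDl// => h.
have : fine (nu A) * C <= fine (nu A) * (C + 1) by rewrite ler_pM2l// lerDl.
by move: nuA_gt0 h => /=; nra.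
Qed.

Lemma image_integrable_horner (p : {poly R}) :
  nu.-integrable [set: R] (fun x => (p.[x])%:E).
Proof.
have mp : measurable_fun [set: R] (fun x => `|p.[x]|).
  by apply: measurableT_comp => //; exact: measurable_horner.
apply/integrableP; split; first by apply/measurable_EFinP; exact: measurable_horner.
have /integrableP[_ p2] := Lfun2_mul_integrable (horner_Lfun2 p) (horner_Lfun2 p).
have sqp : (sqnorm (fun x => `|p.[x]|%R) < +oo)%E.
  apply: le_lt_trans p2; rewrite /sqnorm le_eqVlt; apply/orP; left; apply/eqP.
  apply: eq_integral => x _; rewrite gee0_abs ?lee_fin -?expr2 ?sqr_ge0//.
  by rewrite real_normK ?num_real.
have := image_L1_bound mp (fun x => normr_ge0 _) ltr01; rewrite mul1e => h.
have : (2%:E * \int[nu]_x (`|p.[x]|)%:E < +oo)%E.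
  by apply: le_lt_trans h _; rewrite lte_add_pinfty// ltry.
have [->|] := eqVneq (\int[nu]_x (`|p.[x]|)%:E)%E +oo%E.
  by rewrite gt0_muley.
by rewrite -ltey => h2 _; under eq_integral do rewrite abse_EFin.
Qed.

Let hf := hcoef f.
Let hphi := hcoef phi.

Let density_poly (m : probability mR R) (g : R -> R) (p : {poly R}) :
  g \in Lfun gaussR 2%:E -> (forall x, 0 <= g x) ->
  (forall A, measurable A -> m A = (\int[gauss]_(x in A) (g x)%:E)%E) ->
  m.-integrable [set: R] (fun x => (p.[x])%:E) /\
  \int[m]_x p.[x] = \int[gauss]_x (g x * p.[x]).
Proof.
move=> g2 g0 mE; have mg := Lfun2_measurable g2; have mp := measurable_horner p.
split.
  apply: (@integrable_density _ _ _ gaussR m g mg g0 mE (horner p) mp).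
  exact: (Lfun2_mul_integrable (horner_Lfun2 p) g2).
rewrite /Rintegral (@integral_density _ _ _ gaussR m g mg g0 mE (horner p) mp); congr fine.
by apply: eq_integral => x _; rewrite mulrC.
Qed.

Lemma horner_nHe_add n x y : (nHe n).[a * x + b * y] =
  \sum_(k < n.+1) Num.sqrt ('C(n, k))%:R * a ^+ k * b ^+ (n - k) *
     ((nHe k).[x] * (nHe (n - k)).[y]).
Proof.
rewrite /nHe hornerZ He_add// mulr_sumr; apply: eq_bigr => k _.
have kn : (k <= n)%N by rewrite -ltnS.
rewrite !hornerZ.
have s1 := sqrt_fact_gt0 (R := R) n; have s2 := sqrt_fact_gt0 (R := R) k.
have s3 := sqrt_fact_gt0 (R := R) (n - k).
have E : Num.sqrt (n`!)%:R = Num.sqrt ('C(n, k))%:R * (Num.sqrt (k`!)%:R * Num.sqrt ((n - k)`!)%:R) :> R.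
  by rewrite -!sqrtrM// -!natrM bin_fact.
have C2 : ('C(n, k))%:R = Num.sqrt ('C(n, k))%:R * Num.sqrt ('C(n, k))%:R :> R.
  by rewrite -expr2 sqr_sqrtr.
have c0 : 0 < Num.sqrt ('C(n, k))%:R :> R by rewrite sqrtr_gt0 ltr0n bin_gt0.
rewrite [X in _ * (X * _ * _)]C2 E; move: s2 s3 c0.
move: (Num.sqrt ('C(n, k))%:R) (Num.sqrt (k`!)%:R) (Num.sqrt ((n - k)`!)%:R) => /= u v w v0 w0 u0.
by field; rewrite !gt_eqF.
Qed.

Lemma image_hermite n : \int[nu]_x (nHe n).[x] =
  \sum_(0 <= k < n.+1) Num.sqrt ('C(n, k))%:R * a ^+ k * b ^+ (n - k) * hf k * hphi (n - k)%N.
Proof.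
have mp : measurable_fun [set: R] (fun x => ((nHe n).[x])%:E).
  by apply/measurable_EFinP; exact: measurable_horner.
have ip := image_integrable_horner (nHe n).
have i1 p := (@density_poly m1 f p f_L2 f0 m1E).1.
have i2 p := (@density_poly m2 phi p phi_L2 phi0 m2E).1.
have h1 k : \int[m1]_x (nHe k).[x] = hf k.
  rewrite (@density_poly m1 f _ f_L2 f0 m1E).2.
  by apply: eq_Rintegral => x _; rewrite horner_nHe.
have h2 k : \int[m2]_x (nHe k).[x] = hphi k.
  rewrite (@density_poly m2 phi _ phi_L2 phi0 m2E).2.
  by apply: eq_Rintegral => x _; rewrite horner_nHe.
rewrite /Rintegral (integral_image mS nuE mp ip).
have iS := integrable_image mS nuE mp ip.
rewrite -(@integral12_prod_meas1 _ _ _ _ _ m1 m2 (fun xy => ((nHe n).[S xy])%:E) iS).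
pose c k := Num.sqrt ('C(n, k))%:R * a ^+ k * b ^+ (n - k).
have inner x : fubini_F m2 (fun xy => ((nHe n).[S xy])%:E) x =
    (\sum_(k < n.+1) (c k * hphi (n - k)%N) * (nHe k).[x])%:E.
  rewrite /fubini_F /S /=.
  transitivity (\int[m2]_y ((\sum_(k < n.+1) (c k * (nHe k).[x]) *: nHe (n - k)).[y])%:E)%E.
    apply: eq_integral => y _; rewrite horner_nHe_add horner_sum; congr EFin.
    by apply: eq_bigr => k _; rewrite [in RHS]hornerZ mulrA.
  rewrite -[LHS]fineK; last by apply: integrable_fin_num => //; exact: i2.
  rewrite -[fine _]/(Rintegral _ _ _).
  rewrite (Rintegral_horner_sum i2 _ (fun k => c k * (nHe k).[x]) (fun k => nHe (n - k))).
  by congr EFin; apply: eq_bigr => k _; rewrite h2 mulrAC.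
under eq_integral do rewrite inner.
transitivity (\int[m1]_x (\sum_(k < n.+1) (c k * hphi (n - k)%N) *: nHe k).[x]).
  congr fine; apply: eq_integral => x _; rewrite horner_sum; congr EFin.
  by apply: eq_bigr => k _; rewrite [in RHS]hornerZ.
rewrite (Rintegral_horner_sum i1 _ (fun k => c k * hphi (n - k)%N) nHe) big_mkord.
by apply: eq_bigr => k _; rewrite h1 /c mulrAC.
Qed.

End convolution.

(** * From polynomials to the density *)

Lemma chi2E (R : realType) (k : R -> \bar R) (u : R -> R) :
  (forall x, (k x - 1 = (u x)%:E)%E) -> chi2 k = (sqnorm u `^ 2^-1)%E.
Proof.
move=> ku; rewrite /chi2 unlock /=; congr poweR; apply: eq_integral => x _.
by rewrite ku poweR_EFin powR_mulrn// real_normK ?num_real.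
Qed.

Lemma Lfun2_subr1 (R : realType) (u : R -> R) : u \in Lfun (@gauss R) 2%:E ->
  (u \- horner 1) \in Lfun (@gauss R) 2%:E.
Proof.
move=> u2; have mu := Lfun2_measurable u2.
apply: Lfun2P.
  by apply: measurable_funB => //; exact: measurable_horner.
have /integrableP[_ sqfin] := Lfun2_mul_integrable u2 u2.
have /integrableP[_ sq1fin] := Lfun2_mul_integrable (horner_Lfun2 (-1 : {poly R})) (horner_Lfun2 (-1)).
have := sqnormD mu (measurable_horner (-1 : {poly R})).
have -> : u \+ horner (-1) = u \- horner 1 by apply/funext => x /=; rewrite hornerN.
move/le_lt_trans; apply; apply: lte_add_pinfty; rewrite lte_mul_pinfty// /sqnorm.
- by under eq_integral do rewrite expr2 -[(_ * _)%:E]gee0_abs ?lee_fin -?expr2 ?sqr_ge0 ?expr2//.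
- by under eq_integral do rewrite expr2 -[(_ * _)%:E]gee0_abs ?lee_fin -?expr2 ?sqr_ge0 ?expr2//.
Qed.

Lemma chi2_EFin (R : realType) (u : R -> R) : u \in Lfun (@gauss R) 2%:E ->
  chi2 (EFin \o u) = (Num.sqrt (\int[gauss]_x ((u x - 1) ^+ 2)))%:E.
Proof.
move=> u2; have u12 := Lfun2_subr1 u2.
rewrite (chi2E (u := u \- horner 1)); last by move=> x; rewrite /= hornerC EFinB.
have E : sqnorm (u \- horner 1) = (\int[gauss]_x ((u x - 1) ^+ 2))%:E.
  rewrite /Rintegral fineK.
    by apply: eq_integral => x _; rewrite /= hornerC.
  apply: integrable_fin_num => //.
  have := Lfun2_mul_integrable u12 u12.
  by apply: eq_integrable => // x _; rewrite /= hornerC.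
rewrite E poweR_EFin powR12_sqrt//.
by apply: Rintegral_ge0 => x _; exact: sqr_ge0.
Qed.

(** * From a bound on test functions to a bound on the density *)

Section duality.
Context {R : realType}.
Local Notation gaussR := (@gauss R).
Local Notation mR := (measurableTypeR R).
Variables (nu : probability mR R) (C M : R).
Hypothesis C_ge0 : 0 <= C.
Hypothesis nu_L1 : forall (q : R -> R) (s : R), measurable_fun [set: R] q ->
  (forall x, 0 <= q x) -> 0 < s ->
  (2%:E * \int[nu]_x (q x)%:E <= s%:E * sqnorm q + (C / s)%:E)%E.
Hypothesis nu_horner : forall p : {poly R},
  nu.-integrable [set: R] (fun x => (p.[x])%:E).
Hypothesis nu_poly : forall p : {poly R},
  2 * (\int[nu]_x p.[x] - gexp p) <= gexp (p ^+ 2) + M ^+ 2.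

Lemma integrable_bounded (m : probability mR R) (q : R -> R) (B : R) :
  measurable_fun [set: R] q -> (forall x, `|q x| <= B) ->
  m.-integrable [set: R] (fun x => (q x)%:E).
Proof.
move=> mq qB; apply: (@le_integrable _ _ _ m setT measurableT _ (EFin \o cst B)).
- exact/measurable_EFinP.
- by move=> x _; rewrite /= lee_fin (le_trans (qB x))// ler_norm.
- exact: finite_measure_integrable_cst.
Qed.

Lemma sqr_young (u v e : R) : 0 < e ->
  (u - v) ^+ 2 <= (1 + e) * u ^+ 2 + (1 + e^-1) * v ^+ 2.
Proof.
move=> e0; rewrite -subr_ge0 (_ : _ - _ = e^-1 * (e * u + v) ^+ 2).
  by rewrite mulr_ge0 ?sqr_ge0// invr_ge0 ltW.
by field; rewrite gt_eqF.
Qed.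

Lemma image_L1_real (u : R -> R) (s : R) :
  nu.-integrable [set: R] (fun x => (u x)%:E) ->
  gaussR.-integrable [set: R] (fun x => (u x ^+ 2)%:E) -> 0 < s ->
  2 * \int[nu]_x u x <= s * (\int[gauss]_x (u x ^+ 2)) + C / s.
Proof.
move=> iu iu2 s0.
have /measurable_EFinP mu := measurable_int nu iu.
have mnu : measurable_fun [set: R] (fun x => `|u x|) by exact: measurableT_comp.
have := nu_L1 mnu (fun x => normr_ge0 _) s0.
have -> : (\int[nu]_x (`|u x|%R)%:E = (\int[nu]_x `|u x|)%:E)%E.
  rewrite /Rintegral fineK//; apply: integrable_fin_num => //.
  exact: (integrable_abse iu).
have -> : (sqnorm (fun x => `|u x|%R) = (\int[gauss]_x (u x ^+ 2))%:E)%E.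
  rewrite /Rintegral fineK; last exact: integrable_fin_num.
  by apply: eq_integral => x _; rewrite real_normK ?num_real.
rewrite -!EFinM -EFinD lee_fin => h; apply: le_trans h.
rewrite ler_wpM2l//; apply: le_trans (ler_norm _) _.
exact: le_normr_Rintegral.
Qed.

Lemma gauss_L1_real (u : R -> R) (s : R) :
  gaussR.-integrable [set: R] (fun x => (u x)%:E) ->
  gaussR.-integrable [set: R] (fun x => (u x ^+ 2)%:E) -> 0 < s ->
  - (2 * \int[gauss]_x u x) <= s * (\int[gauss]_x (u x ^+ 2)) + s^-1.
Proof.
move=> iu iu2 s0.
have i1 : gaussR.-integrable [set: R] (EFin \o cst s^-1).
  exact: finite_measure_integrable_cst.
have E1 : \int[gauss]_x (cst s^-1 x : R) = s^-1 :> R.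
  by rewrite Rintegral_cst// [X in fine X]probability_setT mulr1.
have isu : gaussR.-integrable [set: R] (EFin \o (fun x => s * u x ^+ 2)).
  by have := integrableZl measurableT s iu2; apply: eq_integrable.
rewrite -[X in _ <= _ + X]E1 -RintegralZl// -RintegralD// -mulNr -RintegralZl//.
apply: le_Rintegral => //.
- by have := integrableZl measurableT (-2) iu; apply: eq_integrable.
- by have := integrableD measurableT isu i1; apply: eq_integrable.
- move=> x _ /=; rewrite -subr_ge0 (_ : _ - _ = s^-1 * (s * u x + 1) ^+ 2).
    by rewrite mulr_ge0 ?sqr_ge0// invr_ge0 ltW.
  by field; rewrite gt_eqF.
Qed.

Lemma image_bounded (q : R -> R) (B : R) : measurable_fun [set: R] q ->
  (forall x, `|q x| <= B) ->
  2 * (\int[nu]_x q x - \int[gauss]_x q x) <= \int[gauss]_x (q x ^+ 2) + M ^+ 2.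
Proof.
move=> mq qB; set Sq := \int[gauss]_x (q x ^+ 2).
have mq2 : measurable_fun [set: R] (fun x => q x ^+ 2) by exact: measurable_funX.
have iq2 : gaussR.-integrable [set: R] (fun x => (q x ^+ 2)%:E).
  apply: (@integrable_bounded gaussR _ (B ^+ 2)) => // x.
  by rewrite normrX lerXn2r ?nnegrE// (le_trans _ (qB x)).
have Sq0 : 0 <= Sq by apply: Rintegral_ge0 => x _; exact: sqr_ge0.
have q2 : q \in Lfun gaussR 2%:E.
  apply: Lfun2P => //; have /integrableP[_] := iq2.
  by under eq_integral do rewrite gee0_abs ?lee_fin ?sqr_ge0//.
apply/ler_addgt0Pr => e e0.
(* With squared error at most [t^2] and [s = 1/t], the errors add up to [t D]: at most [t + C t]
   from [h2], [2 t] from [h3] and [t Sq + 2 t] from [h4]. *)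
pose D := Sq + C + 5.
have D0 : 0 < D by rewrite ltr_wpDl// addr_ge0.
pose t := Num.min 1 (e / D).
have t0 : 0 < t by rewrite lt_min ltr01 divr_gt0.
have t1 : t <= 1 by rewrite ge_min lexx.
have tD : t * D <= e by rewrite -ler_pdivlMr// ge_min lexx orbT.
have tt0 : 0 < t ^+ 2 by rewrite exprn_gt0.
have [p qp] := (poly_approx_bounded mq qB).2 _ tt0.
pose u x := q x - p.[x].
have u2 : u \in Lfun gaussR 2%:E.
  apply: Lfun2P; last by apply: lt_le_trans qp _; rewrite leey.
  by apply: measurable_funB => //; exact: measurable_horner.
have iu2 : gaussR.-integrable [set: R] (fun x => (u x ^+ 2)%:E) := Lfun2_mul_integrable u2 u2.
have [iqn iqg] := (integrable_bounded nu mq qB, integrable_bounded gaussR mq qB).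
have ipg := @integrable_horner R p.
have iun : nu.-integrable [set: R] (fun x => (u x)%:E).
  by have := integrableB measurableT iqn (nu_horner p); apply: eq_integrable.
have iug : gaussR.-integrable [set: R] (fun x => (u x)%:E).
  by have := integrableB measurableT iqg ipg; apply: eq_integrable.
have En : \int[nu]_x q x = \int[nu]_x p.[x] + \int[nu]_x u x.
  rewrite -RintegralD//; last exact: nu_horner.
  by apply: eq_Rintegral => x _; rewrite /u addrC subrK.
have Eg : \int[gauss]_x q x = gexp p + \int[gauss]_x u x.
  rewrite /gexp -RintegralD//.
  by apply: eq_Rintegral => x _; rewrite /u addrC subrK.
set Su := \int[gauss]_x (u x ^+ 2).
have Su0 : 0 <= Su by apply: Rintegral_ge0 => x _; exact: sqr_ge0.
have Sut : Su <= t ^+ 2.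
  rewrite -lee_fin /Su /Rintegral fineK; last exact: integrable_fin_num.
  exact: ltW.
have tV0 : 0 < t^-1 by rewrite invr_gt0.
have tSu : t^-1 * Su <= t by rewrite mulrC ler_pdivrMr// -expr2.
have Sut1 : Su <= t by rewrite (le_trans Sut)// expr2 ler_piMr// ltW.
have h1 := nu_poly p.
have h2 := image_L1_real iun iu2 tV0.
have h3 := gauss_L1_real iug iu2 tV0.
have h4 : gexp (p ^+ 2) <= (1 + t) * Sq + (1 + t^-1) * Su.
  rewrite /Sq /Su -RintegralZl// -RintegralZl//.
  have i1 (c : R) (v : R -> R) : gaussR.-integrable [set: R] (fun x => (v x ^+ 2)%:E) ->
      gaussR.-integrable [set: R] (EFin \o (fun x => c * v x ^+ 2)).
    by move=> iv; have := integrableZl measurableT c iv; apply: eq_integrable.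
  rewrite -RintegralD//; [|exact: i1|exact: i1].
  apply: le_Rintegral => //.
  - exact: integrable_horner.
  - have := integrableD measurableT (i1 (1 + t) q iq2) (i1 (1 + t^-1) u iu2).
    by apply: eq_integrable.
  - move=> x _ /=; rewrite horner_exp.
    by have := sqr_young (q x) (u x) t0; rewrite {1}/u opprB addrCA subrr addr0.
move: h2 h3; rewrite invrK -/Su En Eg => h2 h3.
by rewrite /D in tD; lra.
Qed.

Hypothesis M_ge0 : 0 <= M.
Hypothesis nu_dom : nu `<< gaussR.

(** With [g = h - 1] and [q] its restriction to [|g| <= m], one has [nu(q) - gamma(q) = gamma(q g) =
    gamma(q^2)]. The truncation makes this finite, so it can be subtracted from both sides of the
    duality inequality, which leaves [gamma(q^2) <= M^2] for every [m]. *)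
Lemma chi2_density_le :
  (chi2 (Radon_Nikodym (charge_of_finite_measure nu) gaussR) <= M%:E)%E.
Proof.
set h := Radon_Nikodym _ _.
have cdom : charge_of_finite_measure nu `<< gaussR by [].
have ih : gaussR.-integrable [set: R] h := Radon_Nikodym_integrable cdom.
have hfin x : h x \is a fin_num := Radon_Nikodym_fin_num x cdom.
pose g x := fine (h x) - 1.
have mg : measurable_fun [set: R] g.
  by apply: measurable_funB => //; apply: measurableT_comp (measurable_int _ ih).
pose A m := [set x | `|g x| <= m%:R].
have mA m : measurable (A m).
  rewrite -[A m]setTI; apply: measurable_fun_le => //.
  exact: measurableT_comp.
pose q m x := g x * \1_(A m) x.
have mq m : measurable_fun [set: R] (q m).
  apply: (measurable_funM mg).
  have := measurable_indic (D := setT) (R := R) (mA m).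
  by [].
have qB m x : `|q m x| <= m%:R.
  rewrite /q indicE; have [xA|xA] := boolP (x \in A m); last by rewrite mulr0 normr0.
  by rewrite mulr1; move: xA; rewrite inE.
have qq m x : q m x ^+ 2 = q m x * g x.
  by rewrite /q expr2 indicE; case: (_ \in _); rewrite ?mulr1// ?mulr0 mul0r.
have qM m : (\int[gauss]_x (q m x ^+ 2)%:E <= (M ^+ 2)%:E)%E.
  have iqn := integrable_bounded nu (mq m) (qB m).
  have iqg := integrable_bounded gaussR (mq m) (qB m).
  have iqq : gaussR.-integrable [set: R] (EFin \o (fun x => q m x ^+ 2)).
    apply: (@integrable_bounded gaussR _ (m%:R ^+ 2)); first exact: measurable_funX.
    by move=> x; rewrite normrX lerXn2r ?nnegrE.
  have E : \int[nu]_x q m x - \int[gauss]_x q m x = \int[gauss]_x (q m x ^+ 2).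
    apply/eqP; rewrite subr_eq -RintegralD//; apply/eqP.
    rewrite [LHS]/Rintegral -(@Radon_Nikodym_change_of_variables _ _ _ nu gaussR)//.
    rewrite [RHS]/Rintegral; congr fine; apply: eq_integral => x _.
    rewrite qq /g -[Radon_Nikodym _ _ x](fineK (hfin x)) -EFinM; congr EFin.
    by ring.
  have := image_bounded (mq m) (qB m); rewrite E => hm.
  have : \int[gauss]_x (q m x ^+ 2) <= M ^+ 2 by move: hm; lra.
  rewrite -lee_fin /Rintegral fineK//.
  exact: integrable_fin_num.
have mEq2 m : measurable_fun [set: R] (fun x => (q m x ^+ 2)%:E).
  have mq2 : measurable_fun [set: R] (fun x => q m x ^+ 2) by exact: measurable_funX.
  exact/measurable_EFinP.
have gM : (sqnorm g <= (M ^+ 2)%:E)%E.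
  have nd x : {homo (fun m => (q m x ^+ 2)%:E) : m n / (m <= n)%N >-> (m <= n)%E}.
    move=> m n mn; rewrite lee_fin /q !indicE.
    have [xm|_] := boolP (x \in A m); last by rewrite mulr0 expr0n sqr_ge0.
    have {}xm : A m x by rewrite inE in xm.
    by rewrite mem_set//; apply: (le_trans xm); rewrite ler_nat.
  have lim x : limn (fun m => (q m x ^+ 2)%:E) = (g x ^+ 2)%:E.
    apply/cvg_lim => //; apply: cvg_near_cst; near=> m.
    by rewrite /q indicE mem_set ?mulr1//=; near: m; exact: nbhs_infty_ger.
  rewrite /sqnorm; under eq_integral do rewrite -lim.
  rewrite monotone_convergence//; last first.
    by move=> m x _; rewrite lee_fin sqr_ge0.
  apply: lime_le; last exact: nearW.
  apply: ereal_nondecreasing_is_cvgn => m n mn; apply: ge0_le_integral => //.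
  - by move=> x _; rewrite lee_fin sqr_ge0.
  - exact: mEq2.
  - exact: mEq2.
  - by move=> x _; exact: nd.
rewrite (chi2E (u := g)); last by move=> x; rewrite /g EFinB fineK.
have -> : M%:E = ((M ^+ 2)%:E `^ 2^-1)%E.
  by rewrite poweR_EFin powR12_sqrt ?sqr_ge0// sqrtr_sqr ger0_norm.
apply: gt0_ler_poweR => //.
- by rewrite in_itv/= sqnorm_ge0 leey.
- by rewrite in_itv/= lee_fin sqr_ge0 leey.
Unshelve. all: by end_near. Qed.

End duality.

(** * The inequality for [aU + bV], and the limit of [d_phi] *)

Section assembly.
Context {R : realType}.
Local Notation gaussR := (@gauss R).
Local Notation mR := (measurableTypeR R).

Lemma hcoef_subr1 (u : R -> R) j : u \in Lfun gaussR 2%:E -> (0 < j)%N ->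
  hcoef (u \- horner 1) j = hcoef u j.
Proof.
move=> u2 j0; have iu := Lfun2_mul_integrable u2 (horner_Lfun2 (nHe j)).
have E : \int[gauss]_x (nHe j).[x] = 0 :> R.
  transitivity (gexp (nHe j * nHe 0) : R); first by rewrite nHe0 mulr1.
  by rewrite gexp_nHe; case: j j0 {iu}.
transitivity (\int[gauss]_x (u x * (nHe j).[x]) - \int[gauss]_x (nHe j).[x]).
  rewrite -RintegralB//; last exact: integrable_horner.
  apply: eq_Rintegral => x _.
  by rewrite /= hornerC -horner_nHe mulrBl mul1r.
by rewrite E subr0; apply: eq_Rintegral => x _; rewrite horner_nHe.
Qed.

Lemma bessel_subr1 (u : R -> R) D : u \in Lfun gaussR 2%:E ->
  \sum_(1 <= j < D) hcoef u j ^+ 2 <= \int[gauss]_x ((u x - 1) ^+ 2).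
Proof.
move=> u2; have := bessel D (Lfun2_subr1 u2).
have -> : \int[gauss]_x ((u \- horner 1) x ^+ 2) = \int[gauss]_x ((u x - 1) ^+ 2) :> R.
  by apply: eq_Rintegral => x _; rewrite /= hornerC.
apply: le_trans; rewrite -(big_mkord xpredT (fun i => hcoef (u \- horner 1) i ^+ 2)).
have [->|D0] := posnP D; first by rewrite !big_geq.
rewrite [leRHS]big_ltn// -[leLHS]add0r lerD ?sqr_ge0//.
apply: ler_sum_nat => j /andP[j1 _].
by rewrite hcoef_subr1.
Qed.

Lemma double_le_of_sqr_le (L S M : R) : 0 <= S -> L ^+ 2 <= M ^+ 2 * S ->
  2 * L <= S + M ^+ 2.
Proof.
move=> S0 h; have [L0|L0] := ltP L 0.
  by rewrite (@le_trans _ _ 0) ?addr_ge0 ?sqr_ge0// mulr_ge0_le0// ltW.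
rewrite -(@ler_pXn2r _ 2)// ?nnegrE ?addr_ge0 ?sqr_ge0//; last exact: mulr_ge0.
rewrite (@le_trans _ _ (4 * (M ^+ 2 * S)))//.
  by rewrite exprMn -natrX ler_wpM2l.
by rewrite -subr_ge0 (_ : _ - _ = (S - M ^+ 2) ^+ 2) ?sqr_ge0//; ring.
Qed.

Section polynomial_duality.
Variables (nu : probability mR R) (mom : nat -> R) (M : R).
Hypothesis nu_horner : forall p : {poly R},
  nu.-integrable [set: R] (fun x => (p.[x])%:E).
Hypothesis nu_nHe : forall n, \int[nu]_x (nHe n).[x] = mom n.
Hypothesis mom_le : forall D (Q : nat -> R),
  (\sum_(0 <= n < D) Q n * mom n - \sum_(0 <= n < D | n == 0%N) Q n) ^+ 2
  <= M ^+ 2 * \sum_(0 <= n < D) Q n ^+ 2.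

Lemma horner_duality (p : {poly R}) :
  2 * (\int[nu]_x p.[x] - gexp p) <= gexp (p ^+ 2) + M ^+ 2.
Proof.
have ep := hermite_expansion (leqnn (size p)).
set D := size p in ep; pose Q := hcoef (horner p).
have En : \int[nu]_x p.[x] = \sum_(0 <= n < D) Q n * mom n.
  rewrite {1}ep (Rintegral_horner_sum nu_horner _ Q nHe) big_mkord.
  by apply: eq_bigr => i _; rewrite nu_nHe.
have Eg : gexp p = \sum_(0 <= n < D | n == 0%N) Q n.
  rewrite [RHS]big_mkcond/= big_mkord {1}ep gexp_sum; apply: eq_bigr => i _.
  rewrite gexpZ -[nHe i]mulr1 -nHe0 gexp_nHe.
  by case: eqP => _; rewrite ?mulr1 ?mulr0.
rewrite En Eg; apply: double_le_of_sqr_le.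
  by apply: Rintegral_ge0 => x _; rewrite horner_exp sqr_ge0.
apply: le_trans (mom_le D Q) _; rewrite ler_wpM2l ?sqr_ge0//.
by rewrite (gexp_sqr_expansion (leqnn (size p))) big_mkord.
Qed.

End polynomial_duality.

(** Independence identifies the joint law of [(U, V)] on rectangles, which determine the product
    measure. *)
Lemma law_linear_combination d (T : measurableType d) (P : probability T R)
    (U V : {RV P >-> R}) (a b : R) : independent U V ->
  forall A, measurable A ->
  law (a *: U + b *: V : {RV P >-> R})%R A =
  (law U \x law V)%E ((fun xy : mR * mR => a * xy.1 + b * xy.2) @^-1` A).
Proof.
move=> UV A mA.
have mU : measurable_fun [set: T] (U : T -> mR) by exact: (measurable_funPT U).
have mV : measurable_fun [set: T] (V : T -> mR) by exact: (measurable_funPT V).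
pose W : T -> mR * mR := fun t => (U t, V t).
have mW : measurable_fun [set: T] W by exact: measurable_fun_pair.
pose W_mixin := isMeasurableFun.Build _ _ _ _ W mW.
pose W' : {mfun T >-> (mR * mR)%type} := HB.pack W W_mixin.
rewrite (@product_measure_unique _ _ _ _ _ (law U) (law V) (distribution P W')).
- by [].
- by move=> B C mB mC; exact: UV.
- rewrite -[X in measurable X]setTI.
  by apply: (measurable_funD (measurable_funM _ _) (measurable_funM _ _)).
Qed.

Section convolution_chi2.
Variables (r : nat) (f : R -> R) (phi : {poly R}) (a : R).
Hypothesis f_density : is_density f.
Hypothesis f_L2 : f \in Lfun gaussR 2%:E.
Hypothesis f_moments : moments_match r f.
Hypothesis phi_density : is_density (horner phi).
Hypothesis phi_moments : moments_match r (horner phi).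
Hypothesis HH : hypH r phi.
Hypothesis ha : a_phi r phi < a < 1.
Local Notation b := (Num.sqrt (1 - a ^+ 2)).
Variables m1 m2 nu : probability mR R.
Hypothesis m1E : forall A, measurable A ->
  m1 A = (\int[gauss]_(x in A) (f x)%:E)%E.
Hypothesis m2E : forall A, measurable A ->
  m2 A = (\int[gauss]_(x in A) (phi.[x])%:E)%E.
Hypothesis nuE : forall A, measurable A ->
  nu A = (m1 \x m2)%E ((fun xy : mR * mR => a * xy.1 + b * xy.2) @^-1` A).

Lemma chi2_convolution :
  (chi2 (Radon_Nikodym (charge_of_finite_measure nu) gaussR) <=
   (a ^+ r.+1 * (1 + d_phi r phi a))%:E * chi2 (EFin \o f)
     + ((1 - a ^+ 2) `^ (r.+1%:R / 2))%:E * chi2 (EFin \o horner phi))%E.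
Proof.
have phi_L2 := horner_Lfun2 phi.
have a0 : 0 < a := a_gt0 ha; have /andP[_ a1] := ha.
have b20 : 0 < 1 - a ^+ 2 by rewrite subr_gt0 expr_lt1// ltW.
have b0 : 0 < b by rewrite sqrtr_gt0.
have ab1 : a ^+ 2 + b ^+ 2 = 1 by rewrite sqr_sqrtr ?ltW// addrC subrK.
have b1 : b <= 1.
  by rewrite -[leRHS]sqrtr1 ler_wsqrtr// gerBl sqr_ge0.
have [column row] := mixing_constant_bounds phi_density phi_moments HH ha.
rewrite !chi2_EFin// powR_half; last exact: ltW.
rewrite -!EFinM -EFinD.
set A := a ^+ r.+1 * _ in column row *.
set SF := Num.sqrt _; set SPhi := Num.sqrt (\int[gauss]_x (phi.[x] - 1) ^+ 2).
have SF0 : 0 <= SF by exact: sqrtr_ge0.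
have SPhi0 : 0 <= SPhi by exact: sqrtr_ge0.
have SFE : SF ^+ 2 = \int[gauss]_x (f x - 1) ^+ 2.
  by rewrite sqr_sqrtr//; apply: Rintegral_ge0 => x _; exact: sqr_ge0.
have SPhiE : SPhi ^+ 2 = \int[gauss]_x (phi.[x] - 1) ^+ 2.
  by rewrite sqr_sqrtr//; apply: Rintegral_ge0 => x _; exact: sqr_ge0.
have f0 := density_hcoef f_density f_L2 f_moments.
have phi0 := density_hcoef phi_density phi_L2 phi_moments.
have A0 : 0 <= A.
  by have := column r.+1 0%N (leqnn _); rewrite big_geq.
have nuL1 := image_L1_bound f_density phi_density f_L2 phi_L2 m1E m2E ab1 b0 nuE.
have nuH := image_integrable_horner f_density phi_density f_L2 phi_L2 m1E m2E ab1 b0 nuE.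
have nuHe := image_hermite f_density phi_density f_L2 phi_L2 m1E m2E ab1 b0 nuE.
apply: (chi2_density_le _ nuL1 nuH).
- by apply: mulr_ge0; apply: Rintegral_ge0 => x _; exact: sqr_ge0.
- apply: (horner_duality nuH nuHe) => D Q.
  (* Bessel's inequality, applied to [f - 1] and [phi - 1], makes the chi2 distances admissible
     values of [SF] and [SPhi]. *)
  apply: (schur_bound _ (ltW a0) (ltW b0) b1 _ _ _ _ column row) => //.
  + exact: f0.
  + by move=> j /andP[j0 jr]; rewrite f0// gtn_eqF.
  + exact: phi0.
  + by move=> j /andP[j0 jr]; rewrite phi0// gtn_eqF.
  + by rewrite SFE; exact: bessel_subr1.
  + by rewrite SPhiE; exact: bessel_subr1.
- by apply: addr_ge0; apply: mulr_ge0 => //; rewrite exprn_ge0// ltW.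
- exact: (image_dominated f_density phi_density f_L2 phi_L2 m1E m2E ab1 b0 nuE).
Qed.

End convolution_chi2.

(** Division by [|log a|^(K/2)] leaves a polynomial in [sqrt |log a|], because the sum starts at
    [k = K]; the limit is its value at 0. *)
Lemma d_phi_cvg (r : nat) (phi : {poly R}) : exists l : R,
  `|ln a| `^ (- (r.+1%:R / 2)) * d_phi r phi a @[a --> 1^'-] --> l.
Proof.
set N := deg phi; pose al : R := 2 * (r.+1 + N)%:R * (1 + N%:R / r.+1%:R).
have al0 : 0 <= al by rewrite /al !mulr_ge0// addr_ge0// divr_ge0.
pose p : {poly R} := \sum_(r.+1 <= k < N.+1)
  (`|hcoef (horner phi) k| / Num.sqrt (k`!)%:R * al `^ (k%:R / 2)) *: 'X^(k - r.+1).
exists p.[Num.sqrt `|ln 1|].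
have pc : p.[Num.sqrt `|ln a|] @[a --> (1:R)] --> p.[Num.sqrt `|ln 1|].
  have c1 : `|ln a| @[a --> (1:R)] --> `|ln (1 : R)|.
    by apply: cvg_norm; exact: continuous_ln.
  have c2 := cvg_comp _ _ c1 (@sqrt_continuous R `|ln 1|).
  exact: (cvg_comp _ _ c2 (@continuous_horner R p _)).
apply: cvg_trans (cvg_at_left_filter pc); apply: near_eq_cvg; near=> a.
have a1 : a < 1 by near: a; exact: nbhs_left_lt.
have a0 : 0 < a by near: a; exact: nbhs_left_gt.
have l0 : ln a < 0 by rewrite ln_lt0// a0.
rewrite /p horner_sum /d_phi mulr_sumr big_nat [RHS]big_nat.
apply: eq_bigr => k /andP[rk _]; rewrite hornerZ hornerXn.
have -> : - 2 * (r.+1 + N)%:R * (1 + N%:R / r.+1%:R) * ln a = al * `|ln a|.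
  by rewrite ltr0_norm// /al; ring.
rewrite powRM// -powR_half// mulrCA -!mulrA; congr (_ * (_ * _)).
(* Adding exponents, one of them negative, requires a nonzero base; [a < 1] provides it. *)
rewrite [RHS]mulrCA; congr (_ * _); rewrite -powRD; last by rewrite normr_eq0 (lt_eqF l0) implybT.
by congr powR; rewrite natrB//; field.
Unshelve. all: by end_near. Qed.

End assembly.

Unset Implicit Arguments.

Theorem theorem1p2 (R : realType) (r : nat) (f : R -> R) (phi : {poly R})
    (f_density : is_density f)
    (f_L2 : f \in Lfun gauss 2%:E)
    (f_moments : moments_match r f)
    (phi_density : is_density (horner phi))
    (phi_L2 : horner phi \in Lfun gauss 2%:E)
    (phi_moments : moments_match r (horner phi)) :
  (hypH r phi ->
   forall a : R, a_phi r phi < a < 1 ->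
   forall (d : measure_display) (T : measurableType d) (P : probability T R)
     (U V : {RV P >-> R}),
     has_density U f -> has_density V (horner phi) -> independent U V ->
     (chi2 (density_of (a *: U + Num.sqrt (1 - a ^+ 2) *: V : {RV P >-> R})%R)
      <= (a ^+ r.+1 * (1 + d_phi r phi a))%:E * chi2 (EFin \o f)
         + ((1 - a ^+ 2) `^ (r.+1%:R / 2))%:E * chi2 (EFin \o horner phi))%E)
  /\
  (exists l : R,
     `|ln a| `^ (- (r.+1%:R / 2)) * d_phi r phi a @[a --> 1^'-] --> l).
Proof.
split; last exact: d_phi_cvg.
move=> HH a ha d T P U V fU phiV UV.
set Z : {RV P >-> R} := (_ + _)%R.
have H := @chi2_convolution R r f phi a f_density f_L2 f_moments phi_density
  phi_moments HH ha (law U) (law V) (law Z) fU phiV.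
have nuE := @law_linear_combination R d T P U V a (Num.sqrt (1 - a ^+ 2)) UV.
have Hnu := H nuE.
exact: Hnu.
Qed.
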